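(* For every integer $n$, the universal $SL_2$-character ring of the knot group of the $(-2,3,2n+1)$-pretzel knot $K_{2n+1}$ is reduced and is equal to the ring $\mathbb C[x,y,z]/(P,Q_n)$, where $$P=x-xy+(-3+x^2+y^2)z-xyz^2+z^3,$$ $$Q_n=S_{n-2}(y)+S_{n-3}(y)-S_{n-4}(y)-S_{n-5}(y)-S_{n-2}(y)\,x^2+\big(S_{n-1}(y)+S_{n-3}(y)+S_{n-4}(y)\big)xz-\big(S_{n-2}(y)+S_{n-3}(y)\big)z^2 .$$
   Context: $S_k(y)$, $k\in\mathbb Z$, are the Chebyshev polynomials: $S_0(y)=1$, $S_1(y)=y$, $S_{k+1}(y)=yS_k(y)-S_{k-1}(y)$ for all integers $k$. The knot group has the presentation $\pi_1(S^3\setminus K_{2n+1})=\langle a,w\mid w^nE=Fw^n\rangle$ with $E=awa^{-1}w^{-1}a^{-1}$, $F=a^{-1}w^{-1}awaw^{-1}$. The variables are $x=\mathrm{tr}(a)$, $y=\mathrm{tr}(w)$, $z=\mathrm{tr}(aw)$. Universal $SL_2$-character ring: for every element $u$ of the free group $F_2=\langle a,w\rangle$ there is a unique polynomial $\mathbf P_u\in\mathbb C[x,y,z]$ with $\mathrm{tr}\,r(u)=\mathbf P_u(\mathrm{tr}\,r(a),\mathrm{tr}\,r(w),\mathrm{tr}\,r(aw))$ for all $r:F_2\to SL_2(\mathbb C)$. The universal $SL_2$-character ring of a quotient group $G$ of $F_2$ is the quotient of $\mathbb C[x,y,z]$ by the ideal generated by all $\mathbf P_u-\mathbf P_v$, where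 $u,v\in F_2$ have equal image in $G$. Reduced means that the nilradical is zero. *)

(* Defs.v *)
From HB Require Import structures.
From mathcomp Require Import all_boot all_order all_algebra.
From mathcomp Require Import ring_quotient generic_quotient ring.
From mathcomp Require Import boolp reals.
From mathcomp Require Import complex.
From mathcomp Require Import mpoly.

Set Implicit Arguments.
Unset Strict Implicit.
Unset Printing Implicit Defensive.
Import Order.TTheory GRing.Theory Num.Theory.
Local Open Scope ring_scope.

(* The free group on a and w is realised on freely reduced words.
   The letter (g, e) is a (g = false) or w (g = true), inverted iff e = true. *)
Definition letter : Type := (bool * bool)%type.
HB.instance Definition _ := Countable.on letter.

Definition letter_inv (l : letter) : letter := (l.1, ~~ l.2).

Definition reduced_word (s : seq letter) : bool :=
  sorted (fun l m => m != letter_inv l) s.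

Definition push_letter (l : letter) (s : seq letter) : seq letter :=
  if s is m :: s' then if m == letter_inv l then s' else l :: s else [:: l].

Definition word_mul (s t : seq letter) : seq letter := foldr push_letter t s.

Definition word_inv (s : seq letter) : seq letter := rev (map letter_inv s).

Lemma letter_invK : involutive letter_inv.
Proof. by case=> g e; rewrite /letter_inv /= negbK. Qed.

Lemma push_reduced l s : reduced_word s -> reduced_word (push_letter l s).
Proof.
case: s => [//|m s] /= Hs; case: ifP => [_|/negbT ml]; last by rewrite /= ml.
exact: path_sorted Hs.
Qed.

Lemma push_letterK l s : reduced_word s ->
  push_letter l (push_letter (letter_inv l) s) = s.
Proof.
case: s => [|m s] /=; first by rewrite eqxx.
rewrite letter_invK => Hs; case: eqP => [ml|_] /=; last by rewrite eqxx.
by case: s Hs => [|k s] /= => [_|/andP[/negbTE km _]]; rewrite -ml ?km.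
Qed.

Lemma word_mul_reduced s t : reduced_word t -> reduced_word (word_mul s t).
Proof. by move=> Ht; elim: s => //= l s IH; apply: push_reduced. Qed.

Lemma word_inv_reduced s : reduced_word s -> reduced_word (word_inv s).
Proof.
rewrite /reduced_word /word_inv rev_sorted sorted_map.
apply: sub_sorted => l m /=; apply: contra => /eqP ->.
by rewrite letter_invK.
Qed.

Lemma word_invK : involutive word_inv.
Proof.
by move=> s; rewrite /word_inv map_rev revK -map_comp (eq_map letter_invK) map_id.
Qed.

Lemma push_mul l s t : reduced_word t ->
  word_mul (push_letter l s) t = push_letter l (word_mul s t).
Proof.
move=> Ht; case: s => [//|m s] /=; case: eqP => [->|//].
by rewrite push_letterK // word_mul_reduced.
Qed.

Lemma word_mulA s t u : reduced_word u ->
  word_mul s (word_mul t u) = word_mul (word_mul s t) u.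
Proof. by move=> Hu; elim: s => //= l s ->; rewrite push_mul. Qed.

Lemma word_muls1 s : reduced_word s -> word_mul s [::] = s.
Proof.
elim: s => //= l s IH Hs; rewrite IH; last exact: path_sorted Hs.
by case: s Hs {IH} => //= m s /andP[/negbTE->].
Qed.

Lemma word_mulVs s : word_mul (word_inv s) s = [::].
Proof.
elim: s => // l s IH.
by rewrite /word_mul /word_inv /= rev_cons foldr_rcons /= letter_invK eqxx.
Qed.

Record F2 : Type := MkF2 { word :> seq letter; wordP : reduced_word word }.
HB.instance Definition _ := [isSub for word].
HB.instance Definition _ := [Choice of F2 by <:].

Definition F2_one : F2 := MkF2 (isT : reduced_word [::]).
Definition F2_mul (u v : F2) : F2 := MkF2 (word_mul_reduced u (wordP v)).
Definition F2_inv (u : F2) : F2 := MkF2 (word_inv_reduced (wordP u)).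

Lemma F2_mulA : associative F2_mul.
Proof. by move=> u v t; apply: val_inj; rewrite /= word_mulA // wordP. Qed.
Lemma F2_mul1 : left_id F2_one F2_mul.
Proof. by move=> u; apply: val_inj. Qed.
Lemma F2_muls1 : right_id F2_one F2_mul.
Proof. by move=> u; apply: val_inj; rewrite /= word_muls1 // wordP. Qed.
Lemma F2_mulV : left_inverse F2_one F2_inv F2_mul.
Proof. by move=> u; apply: val_inj; rewrite /= word_mulVs. Qed.
Lemma F2_mulsV : right_inverse F2_one F2_inv F2_mul.
Proof.
by move=> u; apply: val_inj => /=; rewrite -{1}[word u]word_invK word_mulVs.
Qed.

HB.instance Definition _ :=
  isGroup.Build F2 F2_mulA F2_mul1 F2_muls1 F2_mulV F2_mulsV.

Definition a : F2 := MkF2 (isT : reduced_word [:: (false, false)]).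
Definition w : F2 := MkF2 (isT : reduced_word [:: (true, false)]).

Definition zexpg (G : groupType) (g : G) (n : int) : G :=
  match n with Posz k => (g ^+ k)%g | Negz k => (g ^- k.+1)%g end.

Inductive normal_closure (G : groupType) (X : G -> Prop) : G -> Prop :=
| ncl_gen g of X g : normal_closure X g
| ncl_one : normal_closure X 1%g
| ncl_mul g h of normal_closure X g & normal_closure X h :
    normal_closure X (g * h)%g
| ncl_inv g of normal_closure X g : normal_closure X (g^-1)%g
| ncl_conj g h of normal_closure X g : normal_closure X (g ^ h)%g.

Definition knot_E : F2 := (a * w * a^-1 * w^-1 * a^-1)%g.
Definition knot_F : F2 := (a^-1 * w^-1 * a * w * a * w^-1)%g.
Definition knot_relator (n : int) : F2 :=
  ((zexpg w n * knot_E) * (knot_F * zexpg w n)^-1)%g.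

Definition eq_in_knot_group (n : int) (u v : F2) : Prop :=
  normal_closure (fun g => g = knot_relator n) (u * v^-1)%g.

Section TracePolynomials.
Variable C : numClosedFieldType.

Definition SL2_rep (r : F2 -> 'M[C]_2) : Prop :=
  [/\ forall u, \det (r u) = 1, r 1%g = 1%:M
    & forall u v, r (u * v)%g = r u *m r v].

Definition pt3 (x y z : C) : 'I_3 -> C := fun i => [:: x; y; z]`_i.

Definition is_trace_poly (u : F2) (p : {mpoly C[3]}) : Prop :=
  forall r : F2 -> 'M[C]_2, SL2_rep r ->
    \tr (r u) = p.@[pt3 (\tr (r a)) (\tr (r w)) (\tr (r (a * w)%g))].


Lemma mx2P (A B : 'M[C]_2) :
  A 0 0 = B 0 0 -> A 0 1 = B 0 1 -> A 1 0 = B 1 0 -> A 1 1 = B 1 1 -> A = B.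
Proof.
move=> h00 h01 h10 h11; apply/matrixP => i j.
have ord2 (k : 'I_2) : k = 0 \/ k = 1.
  by case: k => [[|[|//]]] lt2; [left|right]; apply: val_inj.
by case: (ord2 i) => ->; case: (ord2 j) => ->.
Qed.

Lemma mul_mx2 (A B : 'M[C]_2) i j : (A *m B) i j = A i 0 * B 0 j + A i 1 * B 1 j.
Proof.
by rewrite mxE !big_ord_recl big_ord0 addr0; congr (_ + _ * _); congr (_ _ _);
  apply: val_inj.
Qed.

Lemma tr_mx2 (A : 'M[C]_2) : \tr A = A 0 0 + A 1 1.
Proof.
by rewrite /mxtrace !big_ord_recl big_ord0 addr0; congr (_ + _); congr (A _ _);
  apply: val_inj.
Qed.

Lemma det_mx2 (A : 'M[C]_2) : \det A = A 0 0 * A 1 1 - A 0 1 * A 1 0.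
Proof.
rewrite (expand_det_row _ 0) !big_ord_recl big_ord0 /cofactor !det_mx11 !mxE.
rewrite addr0 /= /bump /= expr0 expr1 mul1r mulN1r mulrN.
by congr (_ * _ - _ * _); congr (A _ _); apply: val_inj.
Qed.

Lemma cayley2 (A : 'M[C]_2) : \det A = 1 -> A *m A = \tr A *: A - 1%:M.
Proof.
rewrite det_mx2 tr_mx2 => dA; have := dA => /(canRL (subrK _)) d1.
by apply: mx2P; rewrite mul_mx2 !mxE /= ?(mulr0n, mulr1n) -?dA; ring.
Qed.

Lemma swap_mx2 (A W : 'M[C]_2) :
  W *m A = \tr A *: W + \tr W *: A + (\tr (A *m W) - \tr A * \tr W)%:M - A *m W.
Proof.
by apply: mx2P; rewrite !(tr_mx2, mul_mx2, mxE) /= ?(mulr0n, mulr1n); ring.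
Qed.

Lemma letter_ind (Q : F2 -> Prop) :
  Q 1%g -> (forall u, Q u -> Q (a^-1 * u)%g) -> (forall u, Q u -> Q (a * u)%g) ->
  (forall u, Q u -> Q (w^-1 * u)%g) -> (forall u, Q u -> Q (w * u)%g) ->
  forall u, Q u.
Proof.
move=> Q1 QaV Qa QwV Qw [s Hs]; elim: s Hs => [|l s IH] Hs.
  by rewrite (_ : MkF2 Hs = 1%g) //; apply: val_inj.
have Hs' : reduced_word s by exact: path_sorted Hs.
have -> : MkF2 Hs = (MkF2 (isT : reduced_word [:: l]) * MkF2 Hs')%g.
  apply: val_inj => /=; case: s Hs {IH Hs'} => //= m s /andP[/negbTE-> _] //.
have {}IH := IH Hs'.
case: l {Hs} => [[] []].
- rewrite (_ : MkF2 _ = w^-1)%g; [exact: QwV | exact: val_inj].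
- rewrite (_ : MkF2 _ = w)%g; [exact: Qw | exact: val_inj].
- rewrite (_ : MkF2 _ = a^-1)%g; [exact: QaV | exact: val_inj].
- rewrite (_ : MkF2 _ = a)%g; [exact: Qa | exact: val_inj].
Qed.

Lemma SL2_repV r g : SL2_rep r -> r (g^-1)%g = (\tr (r g))%:M - r g.
Proof.
case=> rdet r1 rM; have gV : r g *m r (g^-1)%g = 1%:M by rewrite -rM mulgV.
have Vg : r (g^-1)%g *m r g = 1%:M by rewrite -rM mulVg.
rewrite -[RHS]mul1mx -Vg -mulmxA mulmxBr mul_mx_scalar cayley2 //.
by rewrite opprB addrCA subrr addr0 mulmx1.
Qed.

Lemma is_trace_poly_ex (u : F2) : exists p : {mpoly C[3]}, is_trace_poly u p.
Proof.
pose X : {mpoly C[3]} := 'X_0; pose Y : {mpoly C[3]} := 'X_1.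
pose Z : {mpoly C[3]} := 'X_(@Ordinal 3 2 isT).
pose pt (r : F2 -> 'M[C]_2) := pt3 (\tr (r a)) (\tr (r w)) (\tr (r (a * w)%g)).
pose comb (r : F2 -> 'M[C]_2) (p0 p1 p2 p3 : {mpoly C[3]}) :=
  p0.@[pt r]%:M + p1.@[pt r] *: r a + p2.@[pt r] *: r w
  + p3.@[pt r] *: (r a *m r w).
pose ok v := exists p0 p1 p2 p3 : {mpoly C[3]},
    forall r, SL2_rep r -> r v = comb r p0 p1 p2 p3.
have evX r : X.@[pt r] = \tr (r a) by rewrite mevalXU.
have evY r : Y.@[pt r] = \tr (r w) by rewrite mevalXU.
have evZ r : Z.@[pt r] = \tr (r (a * w)%g) by rewrite mevalXU.
pose evE := (evX, evY, evZ, mevalD, mevalB, mevalN, mevalM, meval1, meval0).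
suff [p0 [p1 [p2 [p3 Hp]]]] : ok u.
  exists (p0 + p0 + X * p1 + Y * p2 + Z * p3) => r Hr; rewrite (Hp r Hr).
  have [_ _ rM] := Hr.
  rewrite /comb !mxtraceD !mxtraceZ mxtrace_scalar -rM !evE; ring.
have ok_a v : ok v -> ok (a * v)%g.
  move=> [p0 [p1 [p2 [p3 Hp]]]].
  exists (- p1), (p0 + X * p1), (- p3), (p2 + X * p3) => r Hr.
  have [rdet _ rM] := Hr; rewrite rM (Hp r Hr) /comb !evE.
  rewrite !mulmxDr mul_mx_scalar -!scalemxAr mulmxA cayley2 // mulmxBl mul1mx.
  by rewrite -scalemxAl; apply: mx2P; rewrite !(mul_mx2, mxE) /= ?(mulr0n, mulr1n); ring.
have ok_w v : ok v -> ok (w * v)%g.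
  move=> [p0 [p1 [p2 [p3 Hp]]]].
  exists ((Z - X * Y) * p1 - p2 - X * p3), (Y * p1 + p3),
    (p0 + X * p1 + Y * p2 + Z * p3), (- p1) => r Hr.
  have [rdet _ rM] := Hr; rewrite rM (Hp r Hr) /comb !evE.
  rewrite !mulmxDr mul_mx_scalar -!scalemxAr mulmxA (swap_mx2 (r a) (r w)) cayley2 //.
  rewrite !(mulmxDl, mulNmx) -!scalemxAl -mulmxA cayley2 // mul_scalar_mx -rM.
  rewrite !(mulmxDr, mulmxN) -!scalemxAr mulmx1 !rM.
  by apply: mx2P; rewrite !(mul_mx2, mxE) /= ?(mulr0n, mulr1n); ring.
have ok_V g P v : (forall r, P.@[pt r] = \tr (r g)) ->
    ok v -> ok (g * v)%g -> ok (g^-1 * v)%g.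
  move=> HP [p0 [p1 [p2 [p3 Hp]]]] [q0 [q1 [q2 [q3 Hq]]]].
  exists (P * p0 - q0), (P * p1 - q1), (P * p2 - q2), (P * p3 - q3) => r Hr.
  have [_ _ rM] := Hr; rewrite rM SL2_repV // mulmxBl -rM (Hq r Hr) (Hp r Hr).
  rewrite mul_scalar_mx /comb !evE HP.
  by apply: mx2P; rewrite !(mul_mx2, mxE) /= ?(mulr0n, mulr1n); ring.
elim/letter_ind: u => [|v|v|v|v] //.
- exists 1, 0, 0, 0 => r [_ r1 _]; rewrite r1 /comb !evE.
  by rewrite !scale0r !addr0.
- by move=> okv; apply: (ok_V _ X) (ok_a _ okv).
- exact: ok_a.
- by move=> okv; apply: (ok_V _ Y) (ok_w _ okv).
- exact: ok_w.
Qed.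

Lemma poly_eval0 (q : {poly C}) : (forall t, q.[t] = 0) -> q = 0.
Proof.
move=> q0; apply/eqP; apply: contraT => nzq.
pose rs : seq C := [seq i%:R | i <- iota 0 (size q)].
have: (size rs < size q)%N.
  apply: max_poly_roots => //; first by apply/allP => t _; apply/rootP.
  rewrite map_inj_uniq ?iota_uniq // => i j /eqP.
  by rewrite eqr_nat => /eqP.
by rewrite size_map size_iota ltnn.
Qed.

Lemma mpoly3_eval0 (p : {mpoly C[3]}) :
  (forall x y z, p.@[pt3 x y z] = 0) -> p = 0.
Proof.
move=> p0; pose N := msize p.
pose i0 : 'I_3 := @Ordinal 3 0 isT; pose i1 : 'I_3 := @Ordinal 3 1 isT.
pose i2 : 'I_3 := @Ordinal 3 2 isT.
pose e (m : 'X_{1..3}) := (m i0 + N * (m i1 + N * m i2))%N.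
pose q : {poly C} := \sum_(m <- msupp p) p@_m *: 'X^(e m).
have q0 : q = 0.
  apply: poly_eval0 => t; rewrite -(p0 t (t ^+ N) (t ^+ (N * N))).
  rewrite mevalE /q horner_sum; apply: eq_bigr => m _.
  rewrite hornerZ hornerXn /e; congr (_ * _).
  rewrite !big_ord_recl big_ord0 mulr1 /pt3 /=.
  rewrite -!exprM -!exprD; congr (_ ^+ _).
  rewrite mulnDr mulnA addnA -!addnA.
  by congr (m _ + (_ * m _ + _ * m _))%N; apply: val_inj.
have ltN m i : m \in msupp p -> (m i < N)%N.
  move=> /msize_mdeg_lt; apply: leq_ltn_trans.
  by rewrite mdegE (bigD1 i) //= leq_addr.
have einj : {in msupp p &, injective e}.
  move=> m m' pm pm' em.
  have [l0 l0'] := (ltN _ i0 pm, ltN _ i0 pm').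
  have [l1 l1'] := (ltN _ i1 pm, ltN _ i1 pm').
  have digit b c b' c' : (b < N)%N -> (b' < N)%N -> (b + N * c = b' + N * c')%N ->
      b = b' /\ c = c'.
    move=> lb lb' E; have N0 : (0 < N)%N by exact: leq_trans lb.
    rewrite ![(N * _)%N]mulnC ![(_ + _ * N)%N]addnC in E.
    split; first by have := congr1 (modn^~ N) E; rewrite /= !modnMDl !modn_small.
    have := congr1 (divn^~ N) E; rewrite /= !divnMDl //.
    by rewrite !divn_small // !addn0.
  have [E0 /digit[] // E1 E2] := digit _ _ _ _ l0 l0' em.
  apply/mnmP => i; case: i => [[|[|[|//]]]] lti.
  - by move: E0; congr (m _ = m' _); apply: val_inj.
  - by move: E1; congr (m _ = m' _); apply: val_inj.
  - by move: E2; congr (m _ = m' _); apply: val_inj.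
apply/mpolyP => m; rewrite mcoeff0; apply/eqP; rewrite mcoeff_eq0.
apply/negP => pm; have := congr1 (fun r : {poly C} => r`_(e m)) q0.
rewrite coef0 /q coef_sum (bigD1_seq m) ?msupp_uniq //= big_seq_cond big1.
  rewrite coefZ coefXn eqxx mulr1 addr0 => /eqP.
  by rewrite mcoeff_eq0 pm.
move=> m' /andP[pm' nm]; rewrite coefZ coefXn; case: eqP => [/einj E|_].
  by rewrite E ?eqxx // in nm; rewrite (E pm pm') eqxx in nm.
by rewrite mulr0.
Qed.

Lemma SL2_rep_ex (A W : 'M[C]_2) : \det A = 1 -> \det W = 1 ->
  exists r, [/\ SL2_rep r, r a = A & r w = W].
Proof.
move=> dA dW.
pose gen (g : bool) := if g then W else A.
have dgen g : \det (gen g) = 1 by case: g.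
have ugen g : gen g \in unitmx by rewrite unitmxE dgen unitr1.
pose mat (l : letter) := if l.2 then invmx (gen l.1) else gen l.1.
pose r (s : seq letter) := foldr (fun l M => mat l *m M) 1%:M s.
have matV l : mat l *m mat (letter_inv l) = 1%:M.
  by case: l => g []; rewrite /mat /= ?mulVmx ?mulmxV.
have rpush l s : r (push_letter l s) = mat l *m r s.
  case: s => [|m s] //=; case: eqP => [->|//] /=.
  by rewrite mulmxA matV mul1mx.
exists (fun u : F2 => r u); split; last 2 first.
- by rewrite /r /= mulmx1.
- by rewrite /r /= mulmx1.
split=> //.
  move=> [s Hs] /=; elim: s {Hs} => [|l s IH] /=; first by rewrite det1.
  by rewrite det_mulmx IH mulr1 /mat; case: l.2; rewrite ?det_inv dgen ?invr1.
move=> [s Hs] [t Ht] /=; elim: s {Hs} => [|l s IH] /=; first by rewrite mul1mx.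
by rewrite rpush IH mulmxA.
Qed.

Lemma SL2_rep_pt (x y z : C) :
  exists r, [/\ SL2_rep r, \tr (r a) = x, \tr (r w) = y & \tr (r (a * w)%g) = z].
Proof.
pose P : {poly C} := 'X^2 - z *: 'X + 1.
have [q /rootP q0] : exists q, root P q.
  apply/closed_rootP; rewrite (_ : size P = 3%N) //.
  rewrite /P -addrA size_polyDl size_polyXn //.
  apply: leq_ltn_trans (size_polyD _ _) _; rewrite size_polyN size_poly1.
  by rewrite gtn_max /= andbT (leq_ltn_trans (size_scale_leq _ _)) // size_polyX.
have {}q0 : q ^+ 2 - z * q + 1 = 0 by rewrite -q0 /P !hornerE.
have nzq : q != 0.
  by apply/eqP => q00; move/eqP: q0; rewrite q00 expr0n mulr0 subr0 add0r oner_eq0.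
pose mx2 (b c d e : C) : 'M[C]_2 :=
  \matrix_(i, j) if i == 0 then (if j == 0 then b else c)
                 else (if j == 0 then d else e).
have [||r [Hr ra rw]] := @SL2_rep_ex (mx2 x (-1) 1 0) (mx2 0 q (- q^-1) y).
- by rewrite det_mx2 !mxE /= mulr0 sub0r mulr1 opprK.
- by rewrite det_mx2 !mxE /= mul0r sub0r mulrN opprK divff.
exists r; have [_ _ rM] := Hr; rewrite rM ra rw; split => //.
- by rewrite tr_mx2 !mxE /= addr0.
- by rewrite tr_mx2 !mxE /= add0r.
rewrite tr_mx2 !mul_mx2 !mxE /=; apply: (mulIf nzq); rewrite mul0r addr0 mulr0.
have -> : z * q = q ^+ 2 + 1 by apply/eqP; rewrite -subr_eq0 -oppr_eq0 -q0; apply/eqP; ring.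
by field.
Qed.

Lemma is_trace_poly_inj (u : F2) (p q : {mpoly C[3]}) :
  is_trace_poly u p -> is_trace_poly u q -> p = q.
Proof.
move=> Hp Hq; apply/eqP; rewrite -subr_eq0; apply/eqP.
apply: mpoly3_eval0 => x y z; have [r [Hr <- <- <-]] := SL2_rep_pt x y z.
by rewrite mevalB -Hp // -Hq // subrr.
Qed.

Definition trace_poly (u : F2) : {mpoly C[3]} :=
  projT1 (cid (is_trace_poly_ex u)).

Lemma trace_polyP (u : F2) : is_trace_poly u (trace_poly u).
Proof. exact: projT2 (cid (is_trace_poly_ex u)). Qed.

End TracePolynomials.

Section GeneratedIdeal.
Variables (A : comNzRingType) (S : A -> Prop).

Definition gen_ideal (p : A) : Prop :=
  exists k (c g : 'I_k -> A), (forall i, S (g i)) /\ p = \sum_i c i * g i.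

Definition gen_ideal_pred : {pred A} := fun p => `[< gen_ideal p >].

Lemma gen_ideal0 : gen_ideal 0.
Proof.
by exists 0%N, (fun=> 0), (fun=> 0); split; [case | rewrite big_ord0].
Qed.

Lemma gen_idealMl (b p : A) : gen_ideal p -> gen_ideal (b * p).
Proof.
move=> [k [c [g [Sg ->]]]]; exists k, (fun i => b * c i), g; split=> //.
by rewrite mulr_sumr; apply: eq_bigr => i _; rewrite mulrA.
Qed.

Lemma gen_idealD (p q : A) : gen_ideal p -> gen_ideal q -> gen_ideal (p + q).
Proof.
move=> [k [c [g [Sg ->]]]] [l [d [h [Sh ->]]]].
pose glue (f1 : 'I_k -> A) (f2 : 'I_l -> A) i :=
  match split i with inl j => f1 j | inr j => f2 j end.
exists (k + l)%N, (glue c d), (glue g h); split.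
  by move=> i; rewrite /glue; case: (split i).
by rewrite big_split_ord /=; congr (_ + _); apply: eq_bigr => i _;
  rewrite /glue ?(unsplitK (inl i)) ?(unsplitK (inr i)).
Qed.

Lemma gen_ideal_zmod_closed : zmod_closed gen_ideal_pred.
Proof.
split=> [|p q /asboolP Ip /asboolP Iq]; apply/asboolP; first exact: gen_ideal0.
by apply: gen_idealD => //; rewrite -mulN1r; apply: gen_idealMl.
Qed.

HB.instance Definition _ :=
  GRing.isZmodClosed.Build A gen_ideal_pred gen_ideal_zmod_closed.

(* {ideal_quot _} is a ring only for ideals known to be proper; here A / (S)
   is made a ring for every S, so that no such proof is needed. *)
Definition quot_ring : Type := Quotient.quot gen_ideal_pred.
HB.instance Definition _ := GRing.Zmodule.on quot_ring.
HB.instance Definition _ := EqQuotient.on quot_ring.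

Definition quot_pi (p : A) : quot_ring :=
  (\pi_(Quotient.quot gen_ideal_pred) p)%qT.
Definition quot_mul (x y : quot_ring) : quot_ring := quot_pi (repr x * repr y).

Lemma quot_repr (x : quot_ring) : quot_pi (repr x) = x.
Proof. exact: reprK. Qed.

Lemma quot_piP (p q : A) : quot_pi p = quot_pi q <-> gen_ideal (p - q).
Proof.
by split=> [/eqP|I]; [|apply/eqP]; rewrite -Quotient.idealrBE => *; apply/asboolP.
Qed.

Lemma quot_piD (p q : A) : quot_pi (p + q) = quot_pi p + quot_pi q.
Proof. exact: (@Quotient.pi_add _ gen_ideal_pred). Qed.

Lemma quot_pi_mul (p q : A) : quot_pi (p * q) = quot_mul (quot_pi p) (quot_pi q).
Proof.
apply/quot_piP; set p' := repr _; set q' := repr _.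
have Ip : gen_ideal (p - p') by apply/quot_piP; rewrite quot_repr.
have Iq : gen_ideal (q - q') by apply/quot_piP; rewrite quot_repr.
rewrite (_ : p * q - p' * q' = q * (p - p') + p' * (q - q')); last by ring.
by apply: gen_idealD; apply: gen_idealMl.
Qed.

Lemma quot_mulA : associative quot_mul.
Proof.
move=> x y z; rewrite -[x]quot_repr -[y]quot_repr -[z]quot_repr.
by rewrite -!quot_pi_mul mulrA.
Qed.

Lemma quot_mulC : commutative quot_mul.
Proof. by move=> x y; rewrite /quot_mul mulrC. Qed.

Lemma quot_mul1 : left_id (quot_pi 1) quot_mul.
Proof. by move=> x; rewrite -[x]quot_repr -quot_pi_mul mul1r. Qed.

Lemma quot_mulDl : left_distributive quot_mul +%R.
Proof.
move=> x y z; rewrite -[x]quot_repr -[y]quot_repr -[z]quot_repr.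
by rewrite -quot_piD -!quot_pi_mul -quot_piD mulrDl.
Qed.

HB.instance Definition _ := GRing.Zmodule_isComPzRing.Build quot_ring
  quot_mulA quot_mulC quot_mul1 quot_mulDl.

Lemma quot_pi_zmod_morphism : zmod_morphism quot_pi.
Proof.
by move=> p q; apply: (addIr (quot_pi q)); rewrite -quot_piD !subrK.
Qed.

Lemma quot_pi_monoid_morphism : monoid_morphism quot_pi.
Proof. by split=> // p q; exact: quot_pi_mul. Qed.

HB.instance Definition _ :=
  GRing.isZmodMorphism.Build A quot_ring quot_pi quot_pi_zmod_morphism.
HB.instance Definition _ :=
  GRing.isMonoidMorphism.Build A quot_ring quot_pi quot_pi_monoid_morphism.

End GeneratedIdeal.

Definition reduced_ring (B : comPzRingType) : Prop :=
  forall (b : B) (k : nat), b ^+ k = 0 -> b = 0.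

Section Chebyshev.
Variables (A : comNzRingType) (y : A).

Definition cheb_up (p : A * A) : A * A := (p.2, y * p.2 - p.1).
Definition cheb_down (p : A * A) : A * A := (y * p.1 - p.2, p.1).

(* The pair (S_k(y), S_(k+1)(y)). *)
Definition cheb_pair (k : int) : A * A :=
  match k with
  | Posz m => iter m cheb_up (1, y)
  | Negz m => iter m.+1 cheb_down (1, y)
  end.

Definition chebS (k : int) : A := (cheb_pair k).1.

Lemma chebS0 : chebS 0 = 1. Proof. by []. Qed.
Lemma chebS1 : chebS 1 = y. Proof. by []. Qed.

Lemma cheb_pairS (k : int) : cheb_pair (k + 1) = cheb_up (cheb_pair k).
Proof.
have downK : cancel cheb_down cheb_up.
  by case=> p q; rewrite /cheb_up /cheb_down /= opprB addrCA subrr addr0.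
case: k => [m|[|m]]; first by rewrite -PoszD addn1.
  by rewrite [cheb_pair (Negz 0)]/= downK.
rewrite (_ : Negz m.+1 + 1 = Negz m); first by rewrite [cheb_pair (Negz m.+1)]iterS downK.
by rewrite !NegzE; ring.
Qed.

Lemma chebS_rec (k : int) : chebS (k + 1) = y * chebS k - chebS (k - 1).
Proof.
have -> : chebS k = (cheb_pair (k - 1)).2.
  by rewrite /chebS -{1}[k](subrK 1) cheb_pairS.
by rewrite /chebS -{1}[k](subrK 1) !cheb_pairS.
Qed.

End Chebyshev.

Section CharacterRing.
Variables (C : numClosedFieldType) (n : int).

Definition char_relation (p : {mpoly C[3]}) : Prop :=
  exists u v : F2, eq_in_knot_group n u v /\ p = trace_poly C u - trace_poly C v.

Definition char_ring : comPzRingType := quot_ring char_relation.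

Definition X : {mpoly C[3]} := 'X_(@Ordinal 3 0 isT).
Definition Y : {mpoly C[3]} := 'X_(@Ordinal 3 1 isT).
Definition Z : {mpoly C[3]} := 'X_(@Ordinal 3 2 isT).
Local Notation S k := (chebS Y k).

Definition poly_P : {mpoly C[3]} :=
  X - X * Y + (- 3%:R + X ^+ 2 + Y ^+ 2) * Z - X * Y * Z ^+ 2 + Z ^+ 3.

Definition poly_Q : {mpoly C[3]} :=
  S (n - 2) + S (n - 3) - S (n - 4) - S (n - 5) - S (n - 2) * X ^+ 2
  + (S (n - 1) + S (n - 3) + S (n - 4)) * (X * Z)
  - (S (n - 2) + S (n - 3)) * Z ^+ 2.

Definition PQ_relation (p : {mpoly C[3]}) : Prop := p = poly_P \/ p = poly_Q.

End CharacterRing.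

(* Main.v *)
Require Import Defs.
From mathcomp Require Import all_boot all_order all_algebra.
From mathcomp Require Import reals complex mpoly.
From mathcomp Require Import ring zify.

(* Put s = S_(n-1)(y), t = S_(n-2)(y); Cayley-Hamilton gives w^n = s w - t, so
   the traces of (w^n E - F w^n) h for h in the basis 1, a, w, aw are explicit
   polynomials.  Those of 1 and w are multiples of P, that of a is Q_n and that
   of aw is a combination; moreover P = tr E - tr F.  The elements g such that
   tr(g h) = tr(h) modulo (P, Q_n) for all h form a normal subgroup, so (P, Q_n)
   is the whole ideal of the character ring.

   For the radical property, P is monic in z and the norm N of Q_n from
   C[x,y,z]/(P) to C[x,y] is monic in y for every n.  Hence C[x,y,z]/(P, Q_n)
   embeds C[x]-linearly in a free C[x]-module: x is not a zero divisor and
   nothing is divisible by all powers of x.  At x = 0 the quotient is reduced: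
   there P = z (z^2 + y^2 - 3), and Q_n restricts to
   (y + 2)(S_(n-3) - S_(n-4)) on z = 0 and to S_n + S_(n-1) on the other factor;
   both have simple roots and the latter is prime to y^2 - 3.  So a nilpotent
   element is divisible by x, with a nilpotent quotient, and therefore by every
   power of x. *)

Set Implicit Arguments.
Unset Strict Implicit.
Unset Printing Implicit Defensive.
Import GRing.Theory Num.Theory.
Import Pdiv.Ring Pdiv.RingMonic.
Local Open Scope ring_scope.

(** * Chebyshev polynomials and the norm of Q_n *)

Lemma int_updown_ind (T : int -> Prop) :
  T 0 -> (forall k, T k -> T (k + 1)) -> (forall k, T k -> T (k - 1)) ->
  forall k, T k.
Proof.
move=> T0 Tup Tdown; elim/int_ind=> // m IH.
  by rewrite -addn1 PoszD; apply: Tup.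
by rewrite -addn1 PoszD opprD; apply: Tdown.
Qed.

Section ChebyshevTheory.
Variables (A : comNzRingType) (y : A).
Local Notation S k := (chebS y k).

Lemma chebSN1 : S (-1) = 0.
Proof. by rewrite /chebS /= mulr1 subrr. Qed.

Lemma chebS_pred k : S (k - 2) = y * S (k - 1) - S k.
Proof.
have -> : k - 2 = k - 1 - 1 by ring.
by have := chebS_rec y (k - 1); rewrite subrK => ->; ring.
Qed.

(** The recursion preserves the form [s^2 - y s t + t^2] in both directions, and the form is 1 at
    [(S_0, S_(-1)) = (1, 0)]. *)
Lemma chebS_pell k : S k ^+ 2 - y * S k * S (k - 1) + S (k - 1) ^+ 2 = 1.
Proof.
elim/int_updown_ind: k => [|k IH|k IH].
- by rewrite sub0r chebSN1 chebS0; ring.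
- by rewrite addrK chebS_rec -IH; ring.
- have -> : k - 1 - 1 = k - 2 by ring.
  by rewrite chebS_pred -IH; ring.
Qed.

(** The recursion is symmetric under reversal and [S_(-1) = 0], so the sequence is odd about the
    index -1. This brings negative indices back to natural ones. *)
Lemma chebS_opp k : S (- k) = - S (k - 2).
Proof.
suff [] : S (- k) = - S (k - 2) /\ S (- (k - 1)) = - S (k - 1 - 2) by [].
elim/int_updown_ind: k => [|k [E0 E1]|k [E0 E1]].
- by rewrite /chebS /=; split; ring.
- split; last by rewrite addrK; exact: E0.
  have -> : - (k + 1) = - (k - 1) - 2 by ring.
  rewrite chebS_pred (_ : - (k - 1) - 1 = - k); last by ring.
  rewrite E0 E1 (_ : k + 1 - 2 = k - 1); last by ring.
  rewrite (_ : k - 1 - 2 = k - 3); last by ring.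
  rewrite (_ : k - 1 = (k - 2) + 1) ?chebS_rec; last by ring.
  by rewrite (_ : k - 2 - 1 = k - 3); ring.
- split=> //.
  have -> : - (k - 1 - 1) = - (k - 1) + 1 by ring.
  rewrite chebS_rec (_ : - (k - 1) - 1 = - k); last by ring.
  rewrite E0 E1 (_ : k - 1 - 1 - 2 = k - 2 - 2); last by ring.
  rewrite (chebS_pred (k - 2)) (_ : k - 2 - 1 = k - 1 - 2); ring.
Qed.

End ChebyshevTheory.

Lemma rmorph_chebS (A B : comNzRingType) (f : {rmorphism A -> B}) (y : A) k :
  f (chebS y k) = chebS (f y) k.
Proof.
suff [] : f (chebS y k) = chebS (f y) k /\
          f (chebS y (k - 1)) = chebS (f y) (k - 1) by [].
elim/int_updown_ind: k => [|k [E0 E1]|k [E0 E1]].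
- by rewrite sub0r !chebSN1 !chebS0 rmorph0 rmorph1.
- by rewrite addrK !chebS_rec rmorphB rmorphM E0 E1.
- have -> : k - 1 - 1 = k - 2 by ring.
  by rewrite !chebS_pred rmorphB rmorphM E0 E1.
Qed.

Lemma size_chebS (A : comNzRingType) (m : nat) :
  (chebS 'X m%:Z \is @monic A) * (size (chebS ('X : {poly A}) m%:Z) = m.+1).
Proof.
(* The size bound on the predecessor makes ['X * S_m] the dominant term of the recursion. *)
suff [? ? _] : [/\ chebS 'X m%:Z \is @monic A,
    size (chebS ('X : {poly A}) m%:Z) = m.+1 &
    (size (chebS ('X : {poly A}) (m%:Z - 1)) <= m)%N] by [].
elim: m => [|m [Sm sm sm1]].
  by rewrite chebS0 sub0r chebSN1 monic1 size_poly1 size_poly0.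
have -> : m.+1%:Z = m%:Z + 1 by lia.
rewrite addrK chebS_rec.
have sX : size ('X * chebS ('X : {poly A}) m%:Z) = m.+2.
  by rewrite mulrC size_mulX ?sm // monic_neq0.
have lt : (size (- chebS ('X : {poly A}) (m%:Z - 1))%R
             < size ('X * chebS ('X : {poly A}) m%:Z)%R)%N.
  by rewrite size_polyN sX ltnS (leq_trans sm1).
split; last by rewrite sm.
- by rewrite monicE lead_coefDl // lead_coef_Mmonic ?monicX // lead_coefX.
- by rewrite size_polyDl.
Qed.

(* The polynomials P and Q_n, the latter in terms of s = S_(n-1)(y) and
   t = S_(n-2)(y). *)
Definition pretzelP (A : comNzRingType) (x y z : A) : A :=
  z ^+ 3 - x * y * z ^+ 2 + (x ^+ 2 + y ^+ 2 - 3%:R) * z + x * (1 - y).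

Definition pretzelQ (A : comNzRingType) (x y z s t : A) : A :=
  y * (y + 1) * s - 2%:R * s + (3%:R * y + 2%:R - y ^+ 2 - y ^+ 3 - x ^+ 2) * t
  + x * (y ^+ 2 * t + y * t - t - y * s) * z + (s - t - y * t) * z ^+ 2.

(* The norm of Q_n from C[x,y,z]/(P) to C[x,y], reduced by the relation
   s^2 - y s t + t^2 = 1 so that its leading term in y becomes visible. *)
Definition pretzelN (A : comNzRingType) (x y s t : A) : A :=
  y * (s ^+ 3 - t ^+ 3) + (3%:R - 2%:R * x ^+ 2) * (s ^+ 3 - t ^+ 3)
  + (x ^+ 2 - 1) ^+ 2 * (s ^+ 2 * t - s * t ^+ 2)
  + (y ^+ 4 + (3%:R - x ^+ 2) * y ^+ 3 + (1 - 3%:R * x ^+ 2) * y ^+ 2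
     + (2%:R * x ^+ 4 - x ^+ 2 - 4%:R) * y
     + (7%:R * x ^+ 2 - 2%:R * x ^+ 4 - 5%:R)) * s
  + (- y ^+ 3 - y ^+ 2 + (2%:R * x ^+ 4 - 5%:R * x ^+ 2 + 4%:R) * y
     + (5%:R - 7%:R * x ^+ 2 + 4%:R * x ^+ 4 - x ^+ 6)) * t.

(** The right-hand side is the product of the values of [q0 + q1 z + q2 z^2] at the three roots of
    the cubic. The witness [u] is the product of the two conjugate values, rewritten in [z]; [v] is
    the cofactor that the cubic then needs. *)
Lemma norm_cubic (A : comNzRingType) (p0 p1 p2 q0 q1 q2 z : A) :
  exists u v,
  (q0 + q1 * z + q2 * z ^+ 2) * u + (z ^+ 3 + p2 * z ^+ 2 + p1 * z + p0) * v =
  q0 ^+ 3 - q0 ^+ 2 * q1 * p2 - 2%:R * q0 ^+ 2 * q2 * p1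
  + q0 ^+ 2 * q2 * p2 ^+ 2 + q0 * q1 ^+ 2 * p1 + 3%:R * q0 * q1 * q2 * p0
  - q0 * q1 * q2 * p1 * p2 - 2%:R * q0 * q2 ^+ 2 * p0 * p2 + q0 * q2 ^+ 2 * p1 ^+ 2
  - q1 ^+ 3 * p0 + q1 ^+ 2 * q2 * p0 * p2 - q1 * q2 ^+ 2 * p0 * p1 + q2 ^+ 3 * p0 ^+ 2.
Proof.
exists (q0 ^+ 2 - q0 * q1 * p2 - 2%:R * q0 * q2 * p1 + q0 * q2 * p2 ^+ 2
  + q1 ^+ 2 * p1 + q1 * q2 * p0 - q1 * q2 * p1 * p2 - q2 ^+ 2 * p0 * p2
  + q2 ^+ 2 * p1 ^+ 2
  + (q1 ^+ 2 * p2 - q0 * q1 - q1 * q2 * p2 ^+ 2 - q2 ^+ 2 * p0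
     + q2 ^+ 2 * p1 * p2) * z
  + (q1 ^+ 2 - q0 * q2 - q1 * q2 * p2 + q2 ^+ 2 * p1) * z ^+ 2).
exists (2%:R * q0 * q1 * q2 + q0 * z * q2 ^+ 2 - q0 * q2 ^+ 2 * p2 - q1 ^+ 3
  - q1 ^+ 2 * z * q2 + q1 ^+ 2 * q2 * p2 + q1 * z * q2 ^+ 2 * p2
  - q1 * q2 ^+ 2 * p1 - z * q2 ^+ 3 * p1 + q2 ^+ 3 * p0).
ring.
Qed.

Lemma norm_pretzelQ (A : comNzRingType) (x y z s t : A) :
  s ^+ 2 - y * s * t + t ^+ 2 = 1 ->
  exists u v, pretzelQ x y z s t * u + pretzelP x y z * v = pretzelN x y s t.
Proof.
move=> rel.
have [u [v uv]] := norm_cubic (x * (1 - y)) (x ^+ 2 + y ^+ 2 - 3%:R) (- (x * y))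
   (y * (y + 1) * s - 2%:R * s + (3%:R * y + 2%:R - y ^+ 2 - y ^+ 3 - x ^+ 2) * t)
   (x * (y ^+ 2 * t + y * t - t - y * s)) (s - t - y * t) z.
exists u, v; rewrite /pretzelQ /pretzelP -(mulNr (x * y)) uv.
(* [K] is the coefficient of the relation [s^2 - y s t + t^2 = 1] in the difference between
   [pretzelN] and the raw norm. *)
pose K := (x ^+ 6 - 2%:R * x ^+ 4 * y - 4%:R * x ^+ 4 + 5%:R * x ^+ 2 * y
    + 7%:R * x ^+ 2 + y ^+ 3 + y ^+ 2 - 4%:R * y - 5%:R) * t
  + (- 2%:R * x ^+ 4 * y + 2%:R * x ^+ 4 + x ^+ 2 * y ^+ 3
     + 3%:R * x ^+ 2 * y ^+ 2 + x ^+ 2 * y - 7%:R * x ^+ 2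
     - y ^+ 4 - 3%:R * y ^+ 3 - y ^+ 2 + 4%:R * y + 5%:R) * s.
have -> : pretzelN x y s t = pretzelN x y s t - K * (s ^+ 2 - y * s * t + t ^+ 2 - 1).
  by rewrite rel subrr mulr0 subr0.
rewrite /pretzelN /K; ring.
Qed.

(** * Degree bounds and monicity of the norm in y *)

Section DegreeBound.
Variable R : comNzRingType.
Implicit Types p q : {poly R}.

Definition deg_le (d : nat) p : bool := (size p <= d.+1)%N.

Lemma deg_leW a b p : deg_le a p -> (a <= b)%N -> deg_le b p.
Proof. by move=> pa ab; apply: leq_trans pa _. Qed.

Lemma deg_leD a p q : deg_le a p -> deg_le a q -> deg_le a (p + q).
Proof.
rewrite /deg_le => pa qa; apply: leq_trans (size_polyD _ _) _.
by rewrite geq_max pa qa.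
Qed.

Lemma deg_leN a p : deg_le a p -> deg_le a (- p).
Proof. by rewrite /deg_le size_polyN. Qed.

Lemma deg_leM a b p q : deg_le a p -> deg_le b q -> deg_le (a + b) (p * q).
Proof.
rewrite /deg_le => pa qb; apply: leq_trans (size_polyMleq _ _) _.
by rewrite -subn1 leq_subLR add1n -addnS -addSn leq_add.
Qed.

Lemma deg_leXn a k p : deg_le a p -> deg_le (k * a) (p ^+ k).
Proof.
move=> pa; elim: k => [|k IH]; first by rewrite expr0 /deg_le size_poly1.
by rewrite exprS mulSn deg_leM.
Qed.

Lemma deg_leX : deg_le 1 'X. Proof. by rewrite /deg_le size_polyX. Qed.

Lemma deg_leC c : deg_le 0 c%:P. Proof. exact: size_polyC_leq1. Qed.

Lemma deg_le1 : deg_le 0 1. Proof. by rewrite -polyC1 deg_leC. Qed.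

Lemma deg_le_nat k : deg_le 0 k%:R. Proof. by rewrite -polyC_natr deg_leC. Qed.

Lemma monic_addl d p r : p \is monic -> size p = d.+2 -> deg_le d r ->
  p + r \is monic.
Proof. by move=> /monicP mp sp rd; rewrite monicE lead_coefDl ?mp // sp. Qed.

End DegreeBound.

Ltac deg_zero :=
  lazymatch goal with
  | |- is_true (deg_le _ (_ + _)) => apply: deg_leD; deg_zero
  | |- is_true (deg_le _ (- _)) => apply: deg_leN; deg_zero
  | |- is_true (deg_le _ (_ * _)) => apply: (@deg_leM _ 0 0); deg_zero
  | |- is_true (deg_le _ (?p ^+ ?k)) => apply: (@deg_leXn _ 0 k); deg_zero
  | |- is_true (deg_le _ 1) => exact: deg_le1
  | |- is_true (deg_le _ (_ *+ _)) => exact: deg_le_nat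
  | |- _ => assumption
  end.

(** The bound is an evar filled in by the search. A factor that is a sum or an opposite is taken for
    a constant coefficient and sent to [deg_zero]. *)
Ltac deg_monomial :=
  lazymatch goal with
  | |- is_true (deg_le _ (_ * _)) => eapply deg_leM; deg_monomial
  | |- is_true (deg_le _ ('X ^+ _)) => eapply deg_leXn; exact: deg_leX
  | |- is_true (deg_le _ 'X) => exact: deg_leX
  | |- is_true (deg_le _ (_ + _)) => apply: (_ : deg_le 0 _); deg_zero
  | |- is_true (deg_le _ (- _)) => apply: (_ : deg_le 0 _); deg_zero
  | |- is_true (deg_le _ (_ ^+ _)) => eapply deg_leXn; deg_monomial
  | |- is_true (deg_le _ 1) => exact: deg_le1
  | |- is_true (deg_le _ (_ *+ _)) => exact: deg_le_nat
  | |- _ => eassumption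
  end.

(* Bounds a sum of products of powers of 'X, coefficients that are sums of
   polynomials of degree 0, and polynomials of known degree. *)
Ltac deg_bound :=
  lazymatch goal with
  | |- is_true (deg_le _ (_ + _)) => apply: deg_leD; deg_bound
  | |- is_true (deg_le _ (- _)) => apply: deg_leN; deg_bound
  | |- _ => eapply deg_leW; [deg_monomial | lia]
  end.

Section NormMonic.
Variable R : comNzRingType.
Implicit Types x s t : {poly R}.

(** ['X * s^3] leads, in degree [3(d+2) + 1], and all other terms have degree at most [3(d+2)]. The
    term ['X^4 * s] attains this bound at d = 0, so a smaller degree of [s] escapes the argument. *)
Lemma pretzelN_monic_up x s t d : deg_le 0 x -> s \is monic -> size s = d.+3 ->
  deg_le d.+1 t -> pretzelN x 'X s t \is monic.
Proof.
move=> dx ms ss dt; have ds : deg_le d.+2 s by rewrite /deg_le ss.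
rewrite (_ : pretzelN x 'X s t = 'X * s ^+ 3 + (- ('X * t ^+ 3)
  + (3%:R - 2%:R * x ^+ 2) * s ^+ 3 - (3%:R - 2%:R * x ^+ 2) * t ^+ 3
  + (x ^+ 2 - 1) ^+ 2 * s ^+ 2 * t - (x ^+ 2 - 1) ^+ 2 * s * t ^+ 2
  + 'X ^+ 4 * s + (3%:R - x ^+ 2) * 'X ^+ 3 * s + (1 - 3%:R * x ^+ 2) * 'X ^+ 2 * s
  + (2%:R * x ^+ 4 - x ^+ 2 - 4%:R) * 'X * s
  + (7%:R * x ^+ 2 - 2%:R * x ^+ 4 - 5%:R) * s
  - 'X ^+ 3 * t - 'X ^+ 2 * t + (2%:R * x ^+ 4 - 5%:R * x ^+ 2 + 4%:R) * 'X * t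
  + (5%:R - 7%:R * x ^+ 2 + 4%:R * x ^+ 4 - x ^+ 6) * t)); last first.
  by rewrite /pretzelN; ring.
have ms3 : s ^+ 3 \is monic by rewrite monic_exp.
apply: (@monic_addl _ (3 * d.+2)).
- by rewrite monicMl ?monicX.
- rewrite -commr_polyX size_mulX ?monic_neq0 //; congr _.+1.
  by rewrite !exprS expr0 mulr1 !size_Mmonic ?monicMl ?monic_neq0 // ss; lia.
- by deg_bound.
Qed.

(** For negative n the degree of [t] is the larger one and [- 'X * t^3] leads, hence the sign in the
    hypothesis on [t]. *)
Lemma pretzelN_monic_down x s t d : deg_le 0 x -> - t \is monic ->
  size t = d.+3 -> deg_le d.+1 s -> pretzelN x 'X s t \is monic.
Proof.
move=> dx mt st ds; have dt : deg_le d.+2 t by rewrite /deg_le st.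
rewrite (_ : pretzelN x 'X s t = 'X * (- t) ^+ 3 + ('X * s ^+ 3
  + (3%:R - 2%:R * x ^+ 2) * s ^+ 3 - (3%:R - 2%:R * x ^+ 2) * t ^+ 3
  + (x ^+ 2 - 1) ^+ 2 * s ^+ 2 * t - (x ^+ 2 - 1) ^+ 2 * s * t ^+ 2
  + 'X ^+ 4 * s + (3%:R - x ^+ 2) * 'X ^+ 3 * s + (1 - 3%:R * x ^+ 2) * 'X ^+ 2 * s
  + (2%:R * x ^+ 4 - x ^+ 2 - 4%:R) * 'X * s
  + (7%:R * x ^+ 2 - 2%:R * x ^+ 4 - 5%:R) * s
  - 'X ^+ 3 * t - 'X ^+ 2 * t + (2%:R * x ^+ 4 - 5%:R * x ^+ 2 + 4%:R) * 'X * t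
  + (5%:R - 7%:R * x ^+ 2 + 4%:R * x ^+ 4 - x ^+ 6) * t)); last first.
  by rewrite /pretzelN; ring.
have mt3 : (- t) ^+ 3 \is monic by rewrite monic_exp.
apply: (@monic_addl _ (3 * d.+2)).
- by rewrite monicMl ?monicX.
- rewrite -commr_polyX size_mulX ?monic_neq0 //; congr _.+1.
  rewrite !exprS expr0 mulr1 !size_Mmonic ?monicMl ?monic_neq0 //.
  by rewrite size_polyN st; lia.
- by deg_bound.
Qed.

(** The two dominance arguments cover n >= 3 and n <= -2. For n = 0, 1, 2, -1 the norm is expanded;
    its degrees in y are 3, 4, 5, 4. *)
Lemma pretzelN_monic x n : deg_le 0 x ->
  pretzelN x 'X (chebS 'X (n - 1)) (chebS 'X (n - 2)) \is monic.
Proof.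
have mXn d r : deg_le d r -> 'X^(d.+1) + r \is @monic R.
  by apply: monic_addl; rewrite ?monicXn ?size_polyXn.
move=> dx; case: n => [[|[|[|d]]]|[|d]].
- rewrite (_ : pretzelN _ _ _ _ = 'X^3 + ('X ^+ 2
    + (- 2%:R * x ^+ 4 + 5%:R * x ^+ 2 - 3%:R) * 'X
    + (x ^+ 6 - 4%:R * x ^+ 4 + 5%:R * x ^+ 2 - 2%:R))); last first.
    by rewrite /chebS /pretzelN /=; ring.
  by apply: mXn; deg_bound.
- rewrite (_ : pretzelN _ _ _ _ = 'X^4 + ((3%:R - x ^+ 2) * 'X ^+ 3
    + (1 - 3%:R * x ^+ 2) * 'X ^+ 2
    + (2%:R * x ^+ 4 - x ^+ 2 - 3%:R) * 'X
    + (- 2%:R * x ^+ 4 + 5%:R * x ^+ 2 - 2%:R))); last first.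
    by rewrite /chebS /pretzelN /=; ring.
  by apply: mXn; deg_bound.
- rewrite (_ : pretzelN _ _ _ _ = 'X^5 + ((4%:R - x ^+ 2) * 'X ^+ 4
    + (3%:R - 5%:R * x ^+ 2) * 'X ^+ 3
    + (3%:R * x ^+ 4 - 3%:R * x ^+ 2 - 4%:R) * 'X ^+ 2
    + (- x ^+ 4 + 4%:R * x ^+ 2 - 3%:R) * 'X
    + (- x ^+ 6 + 4%:R * x ^+ 4 - 5%:R * x ^+ 2 + 2%:R))); last first.
    by rewrite /chebS /pretzelN /=; ring.
  by apply: mXn; deg_bound.
- rewrite (_ : d.+3%:Z - 1 = d.+2%:Z) 1?(_ : d.+3%:Z - 2 = d.+1%:Z); [|lia..].
  by apply: (@pretzelN_monic_up _ _ _ d); rewrite ?/deg_le ?size_chebS.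
- rewrite (_ : pretzelN _ _ _ _ = 'X^4 + ((1 - x ^+ 2) * 'X ^+ 3
    + (- x ^+ 4 + 6%:R * x ^+ 2 - 4%:R) * 'X ^+ 2
    + (x ^+ 6 - 7%:R * x ^+ 4 + 10%:R * x ^+ 2 - 3%:R) * 'X
    + (2%:R * x ^+ 4 - 5%:R * x ^+ 2 + 2%:R))); last first.
    by rewrite /chebS /pretzelN /=; ring.
  by apply: mXn; deg_bound.
- rewrite (_ : Negz d.+1 - 1 = - d.+3%:Z) 1?(_ : Negz d.+1 - 2 = - d.+4%:Z); [|lia..].
  rewrite !chebS_opp (_ : d.+3%:Z - 2 = d.+1%:Z) 1?(_ : d.+4%:Z - 2 = d.+2%:Z); [|lia..].
  by apply: (@pretzelN_monic_down _ _ _ d); 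
    rewrite ?/deg_le ?opprK ?size_polyN ?size_chebS.
Qed.

End NormMonic.

(** * Roots of the restrictions to x = 0 *)

Lemma simple_roots_uniq (F : fieldType) (r : seq F) :
  {in r, forall z, ~~ root (\prod_(u <- r) ('X - u%:P))^`() z} -> uniq r.
Proof.
elim: r => //= z r IH; rewrite big_cons derivM derivXsubC mul1r => simple.
apply/andP; split.
  have := simple z (mem_head _ _); rewrite rootE hornerD hornerM hornerXsubC.
  by rewrite subrr mul0r addr0 -rootE root_prod_XsubC.
apply: IH => u ur; have := simple u; rewrite inE ur orbT => /(_ isT).
apply: contra => /rootP du; rewrite rootE hornerD hornerM du mulr0 addr0 -rootE.
by rewrite root_prod_XsubC.
Qed.

Lemma simple_roots_dvd (F : closedFieldType) (c p : {poly F}) :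
  (forall u, root c u -> ~~ root c^`() u) -> (forall u, root c u -> root p u) ->
  exists q, p = q * c.
Proof.
move=> simple cp; have nz : lead_coef c != 0.
  (* The zero polynomial is excluded: 0 would be a root of it and of its derivative. *)
  rewrite lead_coef_eq0; apply/eqP => c0; have := simple 0.
  by rewrite c0 deriv0 !root0 => /(_ isT).
have [r cE] := closed_field_poly_normal c.
have rootc u : root c u = (u \in r) by rewrite cE rootZ // root_prod_XsubC.
have : uniq r.
  apply: simple_roots_uniq => u; rewrite -rootc => /simple.
  by rewrite {1}cE derivZ rootZ.
rewrite -uniq_rootsE => ur.
have pr : all (root p) r by apply/allP => u; rewrite -rootc; apply: cp.
have [q ->] := uniq_roots_prod_XsubC pr ur.
exists ((lead_coef c)^-1 *: q).
by rewrite {2}cE -scalerAl -scalerAr scalerA mulVf // scale1r.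
Qed.

Section ChebyshevRoots.
Variable C : numClosedFieldType.
Implicit Type u : C.
Local Notation S k := (chebS ('X : {poly C}) k).
Local Notation S_ u k := (chebS (u : C) k).

Lemma chebS_eval u k : (S k).[u] = S_ u k.
Proof. by rewrite -[LHS]/(horner_eval u (S k)) rmorph_chebS /= /horner_eval hornerX. Qed.

(** The defect [dev] of the identity obeys the Chebyshev recursion itself and vanishes at the
    indices 0 and -1. *)
Lemma chebS_deriv k :
  ('X ^+ 2 - 4%:R) * (S k)^`() = (k + 1)%:~R * (S (k + 1) - S (k - 1)) - 'X * S k.
Proof.
pose dev k := ('X ^+ 2 - 4%:R) * (S k)^`()
   - (k + 1)%:~R * (S (k + 1) - S (k - 1)) + 'X * S k.
have devS k' : dev (k' + 1) = 'X * dev k' - dev (k' - 1).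
  have E2 : S (k' + 1 + 1) = 'X * S (k' + 1) - S k' by rewrite chebS_rec addrK.
  have Em : S (k' - 1 - 1) = 'X * S (k' - 1) - S k'.
    by rewrite -chebS_pred; congr chebS; ring.
  rewrite /dev E2 Em addrK subrK chebS_rec derivB derivM derivX mul1r.
  rewrite !rmorphD /=; ring.
suff [] : dev k = 0 /\ dev (k - 1) = 0.
  by move=> E _; rewrite -[RHS]add0r -E /dev; ring.
have d0 : dev 0 = 0.
  rewrite /dev chebS0 /= sub0r chebSN1 chebS1 derivC; ring.
have dm1 : dev (-1) = 0.
  by rewrite /dev chebSN1 deriv0; ring.
elim/int_updown_ind: k => [|k [E0 E1]|k [E0 E1]]; rewrite ?sub0r //.
- by rewrite addrK devS E0 E1; split; ring.
- split=> //; have := devS (k - 1); rewrite subrK E0 E1 => /eqP.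
  by rewrite mulr0 sub0r eq_sym oppr_eq0 => /eqP.
Qed.

Lemma chebS_deriv_eval u k :
  (u ^+ 2 - 4%:R) * (S k)^`().[u]
  = (k + 1)%:~R * (S_ u (k + 1) - S_ u (k - 1)) - u * S_ u k.
Proof.
have := congr1 (horner_eval u) (chebS_deriv k).
rewrite !(rmorphM, rmorphB, rmorph_chebS, rmorphXn, rmorph_nat, rmorph_int) /=.
by rewrite /horner_eval hornerX.
Qed.

Lemma odd_neq0 (k : int) : (2%:R * k + 1)%:~R != 0 :> C.
Proof. rewrite intr_eq0; lia. Qed.

(* At x = 0, Q_n restricts to chebH n on z = 0 and to chebG n on the component
   z^2 + y^2 = 3. *)
Definition chebG n : {poly C} := S n + S (n - 1).
Definition chebH n : {poly C} := ('X + 2%:R%:P) * (S (n - 3) - S (n - 4)).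

(** At a double root [s = - t], and the Pell relation reads [(u + 2) t^2 = 1]. The derivative
    identities give [(2n + 1)(u + 2) t^2 = 0], although the odd integer 2n + 1 is nonzero. *)
Lemma chebG_simple n u : root (chebG n) u -> ~~ root (chebG n)^`() u.
Proof.
rewrite /root /chebG derivD !hornerD !chebS_eval; set s := S_ u n; set t := S_ u (n - 1).
rewrite addr_eq0 => /eqP sE; apply/eqP => d0.
have := chebS_deriv_eval u n; have := chebS_deriv_eval u (n - 1).
rewrite subrK; have -> : n - 1 - 1 = n - 2 by ring.
rewrite chebS_pred chebS_rec -/s -/t => dt ds.
have pell := chebS_pell u n; rewrite -/s -/t in pell.
have : (u ^+ 2 - 4%:R) * ((S n)^`().[u] + (S (n - 1))^`().[u]) = 0 by rewrite d0 mulr0.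
rewrite mulrDr ds dt sE => /eqP E.
have {}pell : (u + 2%:R) * t ^+ 2 = 1 by rewrite -[RHS]pell sE; ring.
have : (2%:R * n + 1)%:~R * ((u + 2%:R) * t ^+ 2) == 0.
  move: E; rewrite !(rmorphD, rmorphM) /= => /eqP E; apply/eqP.
  transitivity (- t * 0); last by rewrite mulr0.
  by rewrite -[in RHS]E; ring.
by rewrite pell mulr1 (negbTE (odd_neq0 n)).
Qed.

Lemma chebH_simple n u : root (chebH n) u -> ~~ root (chebH n)^`() u.
Proof.
have n4 : n - 4 = n - 3 - 1 by ring.
rewrite /root /chebH n4; set m := n - 3.
rewrite derivM derivD derivX derivC addr0 mul1r derivB.
rewrite !(hornerD, hornerM, hornerN) !chebS_eval hornerX hornerC.
set s := S_ u m; set t := S_ u (m - 1).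
have := chebS_deriv_eval u m; have := chebS_deriv_eval u (m - 1).
rewrite subrK; have -> : m - 1 - 1 = m - 2 by ring.
rewrite chebS_pred chebS_rec -/s -/t => dt ds.
have pell := chebS_pell u m; rewrite -/s -/t in pell.
have E : (u ^+ 2 - 4%:R) * ((S m)^`().[u] - (S (m - 1))^`().[u])
   = (m + 1)%:~R * (u * s - t - t) - u * s - (m%:~R * (s - (u * t - s)) - u * t).
  by rewrite mulrBr ds dt.
have odd := odd_neq0 m.
rewrite mulf_eq0 => /orP[]; [rewrite addr_eq0|rewrite subr_eq0] => /eqP e;
  apply/eqP => d0.
(* At u = -2 the factor [u^2 - 4] removes the derivative from [ds], which becomes a linear relation
   between [s] and [t]; the Pell relation is [(s + t)^2 = 1]. *)
- move: E ds dt pell d0; rewrite {}e => _ ds _ pell d0.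
  have st : s - t = 0 by rewrite -[RHS]d0; ring.
  have {ds} sE : s = (m + 1)%:~R * (s + t).
    move/eqP: ds; rewrite (_ : (- 2%:R) ^+ 2 - 4%:R = 0 :> C); last by ring.
    by rewrite mul0r => /eqP E; apply/eqP; rewrite -subr_eq0; apply/eqP;
       apply: (@mulfI _ 2%:R); rewrite ?pnatr_eq0 // mulr0 E; ring.
  have : (2%:R * m + 1)%:~R * ((s + t) ^+ 2) = 0 :> C.
    transitivity ((s - t) * (s + t)); last by rewrite st mul0r.
    rewrite (_ : s - t = 2%:R * s - (s + t)); last by ring.
    by rewrite {2}sE; ring.
  rewrite (_ : (s + t) ^+ 2 = 1); last by rewrite -[RHS]pell; ring.
  by rewrite mulr1 => /eqP; rewrite (negbTE odd).
(* Here [s = t], and the Pell relation is [(2 - u) s^2 = 1]; the contradiction is as for [chebG]. *)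
- move: E d0; rewrite -e subrr add0r => E d0.
  have {}E : (2%:R * m + 1)%:~R * (u - 2%:R) * s = 0 :> C.
    transitivity ((u ^+ 2 - 4%:R) * ((S m)^`().[u] - (S (m - 1))^`().[u])).
      by rewrite E; ring.
    transitivity ((u - 2%:R) * ((u + 2%:R) * ((S m)^`().[u] - (S (m - 1))^`().[u]))).
      by ring.
    by rewrite d0 mulr0.
  have : (2%:R * m + 1)%:~R * ((2%:R - u) * s ^+ 2) = 0 :> C.
    by transitivity (- s * 0); [rewrite -[in RHS]E; ring | rewrite mulr0].
  rewrite (_ : (2%:R - u) * s ^+ 2 = 1); last by rewrite -[RHS]pell -e; ring.
  by rewrite mulr1 => /eqP; rewrite (negbTE odd).
Qed.

(** Up to a common sign [e], the pair [(S_n, S_(n-1))] runs through (1,0), (u,1), (2,u), (u,2),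
    (1,u), (0,1). Each sum has the form [k + l u] with [k^2 <> 3 l^2], hence is nonzero. *)
Lemma chebG_sqr3 n u : u ^+ 2 = 3%:R -> ~~ root (chebG n) u.
Proof.
move=> u3; rewrite /root /chebG hornerD !chebS_eval.
have [e [e1 cases]] : exists e : C, e ^+ 2 = 1 /\
  [\/ S_ u n = e /\ S_ u (n - 1) = 0, S_ u n = e * u /\ S_ u (n - 1) = e,
   S_ u n = e * 2%:R /\ S_ u (n - 1) = e * u |
   [\/ S_ u n = e * u /\ S_ u (n - 1) = e * 2%:R,
    S_ u n = e /\ S_ u (n - 1) = e * u | S_ u n = 0 /\ S_ u (n - 1) = e]].
  elim/int_updown_ind: n => [|k [e [e1 H]]|k [e [e1 H]]].
  - by exists 1; rewrite expr1n sub0r chebSN1; split=> //; apply: Or41.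
  - rewrite addrK chebS_rec.
    case: H => [[-> ->]|[-> ->]|[-> ->]|[[-> ->]|[-> ->]|[-> ->]]].
    + by exists e; split=> //; apply: Or42; split; ring.
    + exists e; split=> //; apply: Or43; split=> //.
      by transitivity (e * u ^+ 2 - e); [ring | rewrite u3; ring].
    + by exists e; split=> //; apply: Or44; apply: Or31; split; ring.
    + exists e; split=> //; apply: Or44; apply: Or32; split=> //.
      by transitivity (e * u ^+ 2 - e * 2%:R); [ring | rewrite u3; ring].
    + by exists e; split=> //; apply: Or44; apply: Or33; split; ring.
    + by exists (- e); rewrite sqrrN; split=> //; apply: Or41; split; ring.
  - have -> : k - 1 - 1 = k - 2 by ring.
    rewrite chebS_pred.
    case: H => [[-> ->]|[-> ->]|[-> ->]|[[-> ->]|[-> ->]|[-> ->]]].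
    + by exists (- e); rewrite sqrrN; split=> //; apply: Or44; apply: Or33; split; ring.
    + by exists e; split=> //; apply: Or41; split; ring.
    + exists e; split=> //; apply: Or42; split=> //.
      by transitivity (e * u ^+ 2 - e * 2%:R); [ring | rewrite u3; ring].
    + by exists e; split=> //; apply: Or43; split; ring.
    + exists e; split=> //; apply: Or44; apply: Or31; split=> //.
      by transitivity (e * u ^+ 2 - e); [ring | rewrite u3; ring].
    + by exists e; split=> //; apply: Or44; apply: Or32; split; ring.
have ne : e != 0 by apply/eqP => e0; move/eqP: e1; rewrite e0 expr0n eq_sym oner_eq0.
have nz (k l : nat) : (k ^ 2 != 3 * l ^ 2)%N -> k%:R + l%:R * u != 0.
  apply: contraNneq => /eqP; rewrite addr_eq0 => /eqP E.
  have : k%:R ^+ 2 = 3%:R * l%:R ^+ 2 :> C by rewrite E sqrrN exprMn u3 mulrC.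
  by rewrite -!natrX -natrM => /eqP; rewrite eqr_nat.
have ok (k l : nat) v : (k ^ 2 != 3 * l ^ 2)%N -> v = e * (k%:R + l%:R * u) -> v != 0.
  by move=> /nz kl ->; rewrite mulf_neq0.
case: cases => [[-> ->]|[-> ->]|[-> ->]|[[-> ->]|[-> ->]|[-> ->]]].
- by apply: (ok 1%N 0%N) => //; ring.
- by apply: (ok 1%N 1%N) => //; ring.
- by apply: (ok 2%N 1%N) => //; ring.
- by apply: (ok 2%N 1%N) => //; ring.
- by apply: (ok 1%N 1%N) => //; ring.
- by apply: (ok 1%N 0%N) => //; ring.
Qed.

End ChebyshevRoots.

(** * The special fiber *)

Lemma rmorph_pretzelP (A B : comNzRingType) (f : {rmorphism A -> B}) x y z :
  f (pretzelP x y z) = pretzelP (f x) (f y) (f z).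
Proof.
by rewrite /pretzelP !(rmorphD, rmorphN, rmorphM, rmorphXn, rmorph1, rmorph_nat).
Qed.

Lemma rmorph_pretzelQ (A B : comNzRingType) (f : {rmorphism A -> B}) x y z s t :
  f (pretzelQ x y z s t) = pretzelQ (f x) (f y) (f z) (f s) (f t).
Proof.
by rewrite /pretzelQ !(rmorphD, rmorphN, rmorphM, rmorphXn, rmorph1, rmorph_nat).
Qed.

Lemma rmorph_pretzelN (A B : comNzRingType) (f : {rmorphism A -> B}) x y s t :
  f (pretzelN x y s t) = pretzelN (f x) (f y) (f s) (f t).
Proof.
by rewrite /pretzelN !(rmorphD, rmorphN, rmorphM, rmorphXn, rmorph1, rmorph_nat).
Qed.

Section PairIdeal.
Variables (A : comNzRingType) (f g : A).

Definition ideal2 (p : A) : Prop := exists u v, p = u * f + v * g.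

Lemma ideal2D p q : ideal2 p -> ideal2 q -> ideal2 (p + q).
Proof.
move=> [u [v ->]] [u' [v' ->]]; exists (u + u'), (v + v'); ring.
Qed.

Lemma ideal2Ml a p : ideal2 p -> ideal2 (a * p).
Proof. by move=> [u [v ->]]; exists (a * u), (a * v); ring. Qed.

Lemma ideal2N p : ideal2 p -> ideal2 (- p).
Proof. by rewrite -mulN1r; apply: ideal2Ml. Qed.

Lemma ideal2_pow p q k : ideal2 (p - q) -> ideal2 (p ^+ k) -> ideal2 (q ^+ k).
Proof.
move=> Ipq Ip; rewrite (_ : q ^+ k = p ^+ k - (p ^+ k - q ^+ k)); last by ring.
by apply: ideal2D => //; apply: ideal2N; rewrite subrXX mulrC; apply: ideal2Ml.
Qed.

End PairIdeal.

Lemma poly_decomp (R : nzRingType) (p : {poly R}) :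
  exists q c, p = q * 'X + c%:P.
Proof.
by elim/poly_ind: p => [|p c _]; [exists 0, 0; rewrite mul0r add0r | exists p, c].
Qed.

Lemma coef_dvd (R : comNzRingType) (c : R) (p : {poly R}) :
  (forall i, exists q, p`_i = c * q) -> exists q, p = c%:P * q.
Proof.
elim/poly_ind: p => [|p a IH] cp; first by exists 0; rewrite mulr0.
have [i|q pE] := IH.
  by have [q] := cp i.+1; rewrite coefD coefMX coefC addr0 /= => ->; exists q.
have [b] := cp 0; rewrite coefD coefMX coefC add0r /= => aE.
by exists (q * 'X + b%:P); rewrite aE pE polyCM mulrDr mulrA.
Qed.

Lemma dvd_Xn_eq0 (R : idomainType) (c : {poly R}) :
  (forall j, exists q, c = 'X^j * q) -> c = 0.
Proof.
move=> /(_ (size c)) [q E]; apply/eqP; apply: contraT => nc.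
have nq : q != 0 by apply: contraNneq nc => q0; rewrite E q0 mulr0.
have := congr1 (fun r : {poly R} => size r) E.
by rewrite mulrC size_mulXn // => ?; move: nq; rewrite -size_poly_gt0; lia.
Qed.

Section Fiber.
Variable C : numClosedFieldType.
(** The outer variable is z, the inner one y. The cofactors [e1] and [e2] record that [q] restricts
    to [c] on z = 0 and to [g] on [h = 0]. *)
Variables (c g b : {poly C}) (e1 e2 q : {poly {poly C}}).
Local Notation h := ('X^2 + b%:P).
Hypotheses (qc : q = c%:P + 'X * e1) (qg : q = g%:P + h * e2).
Hypothesis simple_c : forall u, root c u -> ~~ root c^`() u.
Hypothesis simple_g : forall u, root g u -> ~~ root g^`() u.
Hypothesis coprime_gb : forall u, root g u -> ~~ root b u.

(* A Nullstellensatz: the zeros of the ideal are the points (u, 0) with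
   c(u) = 0 and (u, +-v) with g(u) = 0, v^2 = - b(u) <> 0. *)
Lemma fiber_radical (p : {poly {poly C}}) k :
  ideal2 ('X * h) q (p ^+ k) -> ideal2 ('X * h) q p.
Proof.
move=> Ipk.
have [ev [evX evC]] : exists ev : C -> C -> {rmorphism {poly {poly C}} -> C},
    (forall u v, ev u v 'X = v) /\ (forall u v r, ev u v r%:P = r.[u]).
  by exists (fun u v => horner_eval u \o horner_eval v%:P);
    split=> *; rewrite /= /horner_eval ?hornerX hornerC.
have vanish u v : ev u v ('X * h) = 0 -> ev u v q = 0 -> ev u v p = 0.
  move=> f0 q0; have [r [s E]] := Ipk.
  have /eqP : ev u v (p ^+ k) = 0.
    by rewrite E rmorphD (rmorphM _ r) (rmorphM _ s) f0 q0 !mulr0 addr0.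
  by rewrite rmorphXn expf_eq0 => /andP[_ /eqP].
have [p1 [a pE]] := poly_decomp p.
(* [a] is the restriction of [p] to z = 0. It vanishes at the roots of [c], so subtracting a
   multiple of [q] from [p] leaves a multiple ['X * w]. *)
have [a' aE] : exists a', a = a' * c.
  apply: simple_roots_dvd => // u /rootP cu; apply/rootP.
  have := vanish u 0; rewrite pE qc !(rmorphD, rmorphM) !evX !evC.
  by rewrite cu !mul0r mulr0 !add0r; apply.
pose w := p1 - a'%:P * e1.
have pw : p = a'%:P * q + 'X * w by rewrite pE aE qc polyCM /w; ring.
have mh : h \is monic.
  apply: (@monic_addl _ 1); rewrite ?monicXn ?size_polyXn //.
  by rewrite /deg_le (leq_trans (size_polyC_leq1 _)).
have sh : size h = 3.
  by rewrite size_polyDl size_polyXn // ltnS (leq_trans (size_polyC_leq1 _)).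
have [w1 [A [B wE]]] : exists w1 A B, w = w1 * h + A%:P + B%:P * 'X.
  have := ltn_rmodpN0 w (monic_neq0 mh); rewrite sh => sr.
  have [r1 [A rE]] := poly_decomp (rmodp w h).
  have sr1 : (size r1 <= 1)%N.
    have [->|nr1] := eqVneq r1 0; first by rewrite size_poly0.
    by move: sr; rewrite rE size_MXaddC (negbTE nr1) /= ltnS.
  exists (rdivp w h), A, r1`_0.
  by rewrite -(size1_polyC sr1) -addrA [A%:P + _]addrC -rE -rdivp_eq.
(* Over a root [u] of [g] lie two points z = v and z = -v with v nonzero. The remainder [A + B z] of
   [w] vanishes at both, so both coefficients vanish at [u]. *)
have AB u : root g u -> root A u /\ root B u.
  move=> gu; have bu := coprime_gb gu.
  have line v : v ^+ 2 = - b.[u] -> A.[u] + B.[u] * v = 0.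
    move=> v2.
    have nv : v != 0.
      apply: contraNneq bu => v0; rewrite rootE -oppr_eq0 -v2 v0 expr0n //.
    have hv : ev u v h = 0 by rewrite rmorphD rmorphXn evX evC v2 addNr.
    have qv : ev u v q = 0 by rewrite qg rmorphD rmorphM hv mul0r addr0 evC (rootP gu).
    have : ev u v p = v * (A.[u] + B.[u] * v).
      rewrite pw wE rmorphD (rmorphM _ a'%:P) qv mulr0 add0r (rmorphM _ 'X) evX.
      by rewrite !(rmorphD _ (_ + _)) rmorphD (rmorphM _ w1) hv mulr0 add0r rmorphM
         evX !evC.
    rewrite vanish ?rmorphM ?hv ?mulr0 // => /esym/eqP.
    by rewrite mulf_eq0 (negbTE nv) => /eqP.
  pose v := sqrtC (- b.[u]).
  have v2 : v ^+ 2 = - b.[u] by rewrite sqrtCK.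
  have nv : v != 0 by rewrite sqrtC_eq0 oppr_eq0.
  have E1 := line v v2; have := line (- v); rewrite sqrrN => /(_ v2) E2.
  have two : 2%:R != 0 :> C by rewrite pnatr_eq0.
  split; apply/rootP; [apply: (mulfI two) | apply: (mulfI two); apply: (mulIf nv)].
    by rewrite mulr0 -[RHS]addr0 -{1}E1 -E2; ring.
  by rewrite mulr0 mul0r -[RHS]subr0 -{1}E1 -E2; ring.
have [A' AE] := simple_roots_dvd simple_g (fun u gu => (AB u gu).1).
have [B' BE] := simple_roots_dvd simple_g (fun u gu => (AB u gu).2).
(* The remainder of [w] modulo [h] is now [d * g], and [g] is [q - h * e2]; the coefficients are
   read off from this. *)
pose d := A'%:P + B'%:P * 'X.
exists (w1 - d * e2), (a'%:P + 'X * d).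
have -> : p = a'%:P * q + 'X * (w1 * h + d * g%:P).
  by rewrite pw wE AE BE !polyCM /d; ring.
have -> : g%:P = q - h * e2 by rewrite qg addrK.
ring.
Qed.

End Fiber.

(** * The ideal (P, Q_n) is radical *)

Lemma pretzelP_monic (R : comNzRingType) (x y : {poly R}) :
  deg_le 0 x -> deg_le 0 y -> pretzelP x y 'X \is monic.
Proof.
move=> dx dy; have -> : pretzelP x y 'X = 'X^3
    + (- (x * y * 'X ^+ 2) + (x ^+ 2 + y ^+ 2 - 3%:R) * 'X + x * (1 - y)).
  by rewrite /pretzelP; ring.
apply: (@monic_addl _ 2); rewrite ?monicXn ?size_polyXn //.
by deg_bound.
Qed.

(* Reduction modulo (f, g) realised in a free R-module: multiplication by the
   cofactor u turns g into its norm N, and remainders modulo f and N are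
   unique. *)
Lemma ideal2_linear_test (R : idomainType) (f g u v : {poly {poly R}}) (N : {poly R}) :
  f \is monic -> N \is monic -> g * u + f * v = N%:P ->
  exists nu : {poly {poly R}} -> {poly {poly R}},
  [/\ forall p q, nu (p + q) = nu p + nu q,
      forall c p, nu (c%:P%:P * p) = c%:P%:P * nu p
    & forall p, nu p = 0 <-> ideal2 f g p].
Proof.
move=> mf mN uv.
(* Reducing [p * u] modulo [f] turns multiples of [g] into multiples of [N]; the second,
   coefficientwise reduction kills these. *)
pose red p := rmodp (p * u) f.
have redD p q : red (p + q) = red p + red q by rewrite /red mulrDl rmodpD.
have redZ c p : red (c%:P * p) = c%:P * red p.
  by rewrite /red -mulrA mul_polyC rmodpZ // mul_polyC.
pose nu p := map_poly (fun c => rmodp c N) (red p).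
have coef_nu p i : (nu p)`_i = rmodp (red p)`_i N by rewrite coef_map_id0 ?rmod0p.
have nuD p q : nu (p + q) = nu p + nu q.
  by apply/polyP => i; rewrite coefD !coef_nu redD coefD rmodpD.
exists nu; split=> // [c p|p].
  apply/polyP => i; rewrite coefCM !coef_nu redZ coefCM.
  by rewrite mul_polyC rmodpZ // mul_polyC.
split=> [nu0|[a [b ->]]]; last first.
  rewrite nuD (_ : nu (a * f) = 0) ?add0r; last first.
    apply/polyP => i; rewrite coef_nu coef0 /red mulrAC rmodp_mull // coef0.
    by rewrite rmod0p.
  apply/polyP => i; rewrite coef_nu coef0 /red.
  rewrite (_ : b * g * u = N *: b - b * v * f); last by rewrite -mul_polyC -uv; ring.
  by rewrite rmodpB // rmodpZ // rmodp_mull // subr0 coefZ mulrC rmodp_mull.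
have [beta redE] : exists beta, red p = N%:P * beta.
  apply: coef_dvd => i; exists (rdivp (red p)`_i N).
  by rewrite mulrC {1}(rdivp_eq mN (red p)`_i) -coef_nu nu0 coef0 addr0.
have puE := rdivp_eq mf (p * u); rewrite -/(red p) redE in puE.
(* Multiplying by [g] turns [p * u = N * beta] into [N * p = N * beta * g] modulo [f]; the nonzero
   scalar [N] then cancels from the remainder. *)
have /eqP : rmodp (N *: (p - beta * g)) f = 0.
  apply/rmodp_eq0P/(rdvdpP mf); exists (p * v + rdivp (p * u) f * g).
  rewrite -mul_polyC; transitivity (g * (p * u) + p * v * f - N%:P * (beta * g)).
    by rewrite -uv; ring.
  by rewrite {1}puE; ring.
rewrite rmodpZ // scale_poly_eq0 (negbTE (monic_neq0 mN)) /= => /eqP.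
move=> /rmodp_eq0P/(rdvdpP mf) [a E].
by exists a, beta; rewrite -E subrK.
Qed.

(* C[x,y,z] with x innermost, so that P is monic in the outer variable z and
   the norm of Q_n is monic in the middle one, y. *)
Section Radical.
Variables (C : numClosedFieldType) (n : int).
Local Notation T := {poly {poly {poly C}}}.
Local Notation x := ('X%:P%:P : T).
Local Notation y := ('X%:P : T).
Local Notation z := ('X : T).
Local Notation P := (pretzelP x y z).
Local Notation Q := (pretzelQ x y z (chebS y (n - 1)) (chebS y (n - 2))).
Local Notation N :=
  (pretzelN ('X%:P) 'X (chebS 'X (n - 1)) (chebS 'X (n - 2)) : {poly {poly C}}).

Lemma monicN : N \is monic.
Proof. by apply: pretzelN_monic; apply: deg_leC. Qed.

Lemma monicP : P \is monic.
Proof. by apply: pretzelP_monic; apply: deg_leC. Qed.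

Lemma norm_relation : exists u v : T, Q * u + P * v = N%:P.
Proof.
have rel := chebS_pell y (n - 1); rewrite (_ : n - 1 - 1 = n - 2) in rel; last by ring.
have [u [v E]] := norm_pretzelQ x z rel.
by exists u, v; rewrite E rmorph_pretzelN /= !(rmorph_chebS polyC).
Qed.

Lemma pretzel_linear_test : exists nu : T -> T,
  [/\ forall p q, nu (p + q) = nu p + nu q,
      forall p, nu (x * p) = x * nu p
    & forall p, nu p = 0 <-> ideal2 P Q p].
Proof.
have [u [v uv]] := norm_relation.
have [nu [nuD nuC nuP]] := ideal2_linear_test monicP monicN uv.
by exists nu; split.
Qed.

Lemma x_torsion_free p : ideal2 P Q (x * p) -> ideal2 P Q p.
Proof.
have [nu [_ nux nuP]] := pretzel_linear_test => /nuP; rewrite nux => /eqP.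
by rewrite mulf_eq0 !polyC_eq0 polyX_eq0 => /eqP/nuP.
Qed.

Lemma special_fiber_radical p k : ideal2 P Q (p ^+ k) ->
  exists p1, ideal2 P Q (p - x * p1).
Proof.
(* [e] sets x = 0 and [l] is its section by polynomials constant in x; an element of the kernel of
   [e] is a multiple of x. *)
pose e : {rmorphism T -> {poly {poly C}}} := map_poly (map_poly (horner_eval 0)).
pose l : {rmorphism {poly {poly C}} -> T} := map_poly (map_poly polyC).
have ker q : e q = 0 -> exists q1, q = x * q1.
  move=> eq0; apply: coef_dvd => i; apply: coef_dvd => j; exists (rdivp q`_i`_j 'X).
  have := congr1 (fun r : {poly {poly C}} => r`_i`_j) eq0.
  rewrite !coef_map !coef0 /= /horner_eval => q0.
  by rewrite mulrC rdivpK ?monicX // -['X]subr0 -polyC0 rdvdp_XsubCl; apply/rootP.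
have le q : e (l q) = q.
  by apply/polyP => i; apply/polyP => j; rewrite !coef_map /= /horner_eval hornerC.
have ex : e x = 0.
  by rewrite /= !map_polyC /= map_polyC /= /horner_eval hornerX !polyC0.
have ey : e y = 'X%:P by rewrite /= map_polyC /= map_polyX.
have ez : e z = 'X by rewrite /= map_polyX.
pose s : {poly C} := chebS 'X (n - 1); pose t : {poly C} := chebS 'X (n - 2).
have eP : e P = 'X * ('X^2 + ('X ^+ 2 - 3%:R)%:P).
  rewrite rmorph_pretzelP ex ey ez rmorphB rmorphXn rmorph_nat /pretzelP; ring.
have eQ : e Q = pretzelQ 0 'X%:P 'X s%:P t%:P.
  by rewrite rmorph_pretzelQ !(rmorph_chebS e) ex ey ez -!(rmorph_chebS polyC).
have n3 : chebS 'X (n - 3) = 'X * t - s :> {poly C}.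
  have := chebS_pred ('X : {poly C}) (n - 1).
  by rewrite (_ : n - 1 - 2 = n - 3) 1?(_ : n - 1 - 1 = n - 2); [|ring..].
have n4 : chebS 'X (n - 4) = 'X * ('X * t - s) - t :> {poly C}.
  have := chebS_pred ('X : {poly C}) (n - 2); rewrite -n3.
  by rewrite (_ : n - 2 - 2 = n - 4) 1?(_ : n - 2 - 1 = n - 3); [|ring..].
have n0 : chebS 'X n = 'X * s - t :> {poly C}.
  have := chebS_rec ('X : {poly C}) (n - 1).
  by rewrite subrK (_ : n - 1 - 1 = n - 2); last by ring.
(* The restriction of Q to x = 0 is divided with remainder in two ways, by z and by
   [z^2 + y^2 - 3]. *)
have eQH : e Q = (chebH C n)%:P
    + 'X * ('X * (s%:P - t%:P - 'X%:P * t%:P)).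
  rewrite eQ /chebH n3 n4 polyC_natr !(rmorphD, rmorphN, rmorphM, rmorph_nat).
  rewrite /pretzelQ; ring.
have eQG : e Q = (chebG C n)%:P
    + ('X^2 + ('X ^+ 2 - 3%:R)%:P) * (s%:P - t%:P - 'X%:P * t%:P).
  rewrite eQ /chebG n0 -/s !(rmorphD, rmorphN, rmorphM, rmorphXn, rmorph_nat).
  rewrite /pretzelQ; ring.
have gb u : root (chebG C n) u -> ~~ root ('X ^+ 2 - 3%:R) u.
  apply: contraTN => /rootP; rewrite hornerD hornerN hornerXn -polyC_natr hornerC.
  by move=> /eqP; rewrite subr_eq0 => /eqP; apply: chebG_sqr3.
move=> [a [b E]].
have [|u [v epE]] := fiber_radical eQH eQG (@chebH_simple C n)
  (@chebG_simple C n) gb (p := e p) (k := k).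
  by rewrite -eP; exists (e a), (e b); rewrite -rmorphXn E rmorphD !rmorphM.
rewrite -eP in epE.
have [|p1 p1E] := ker (p - (l u * P + l v * Q)).
  by rewrite rmorphB (rmorphD e) !(rmorphM e) !le epE subrr.
by exists p1; exists (l u), (l v); rewrite -p1E; ring.
Qed.

Lemma pretzel_radical p k : ideal2 P Q (p ^+ k) -> ideal2 P Q p.
Proof.
have [nu [nuD nux nuP]] := pretzel_linear_test => Ip; apply/nuP.
have nuN q : nu (- q) = - nu q.
  apply/eqP; rewrite -addr_eq0 -nuD addNr; apply/eqP/nuP.
  by exists 0, 0; rewrite !mul0r addr0.
(* Each round replaces [q] by [q1] with [q] congruent to [x * q1]; as x can be cancelled modulo the
   ideal, [q1] is again nilpotent there. *)
have approx j : exists q, ideal2 P Q (q ^+ k) /\ nu p = x ^+ j * nu q.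
  elim: j => [|j [q [Iq E]]]; first by exists p; rewrite expr0 mul1r.
  have [q1 Iq1] := special_fiber_radical Iq; exists q1; split; last first.
    move/nuP/eqP: Iq1; rewrite nuD nuN subr_eq0 E => /eqP ->.
    by rewrite nux mulrA -exprSr.
  have := ideal2_pow Iq1 Iq; rewrite exprMn.
  (* The induction is on the exponent of x alone, with [q1 ^+ k] fixed, so the factors x are
     cancelled one at a time. *)
  elim: (k in x ^+ k) => [|m IH]; first by rewrite mul1r.
  by rewrite exprS -mulrA => /x_torsion_free.
apply/polyP => i; apply/polyP => j; rewrite !coef0; apply: dvd_Xn_eq0 => m.
have [q [_ ->]] := approx m; exists (nu q)`_i`_j.
by rewrite -!rmorphXn /= !coefCM.
Qed.

End Radical.

(** * Traces *)

Section Representations.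
Variable C : numClosedFieldType.
Local Notation tp := (trace_poly C).
Local Notation X := (X C).
Local Notation Y := (Y C).
Local Notation Z := (Z C).

Definition mx22 (b c d e : C) : 'M[C]_2 :=
  \matrix_(i, j) if i == 0 then (if j == 0 then b else c)
                 else (if j == 0 then d else e).

Lemma mx22_mul b c d e b' c' d' e' :
  mx22 b c d e *m mx22 b' c' d' e' =
  mx22 (b * b' + c * d') (b * c' + c * e') (d * b' + e * d') (d * c' + e * e').
Proof. by apply: mx2P; rewrite mul_mx2 !mxE. Qed.

Lemma mx22_tr b c d e : \tr (mx22 b c d e) = b + e.
Proof. by rewrite tr_mx2 !mxE. Qed.

Definition pt (r : F2 -> 'M[C]_2) : 'I_3 -> C :=
  pt3 (\tr (r a)) (\tr (r w)) (\tr (r (a * w)%g)).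

(* Every point (x, y, z) is the trace of such a pair: take z = l + 1/l. *)
Definition normal_rep (x y l : C) (r : F2 -> 'M[C]_2) : Prop :=
  [/\ SL2_rep r, l != 0, r a = mx22 x (-1) 1 0 & r w = mx22 0 l (- l^-1) y].

Lemma mpoly_rep_eq (p q : {mpoly C[3]}) :
  (forall x y l r, normal_rep x y l r -> p.@[pt r] = q.@[pt r]) -> p = q.
Proof.
move=> pq; apply/eqP; rewrite -subr_eq0; apply/eqP; apply: mpoly3_eval0 => x y z.
have two : 2%:R != 0 :> C by rewrite pnatr_eq0.
(* [l] and [m] are the roots of [T^2 - z T + 1], so that [l + l^-1 = z]. *)
pose d := sqrtC (z ^+ 2 - 4%:R); have d2 : d ^+ 2 = z ^+ 2 - 4%:R by rewrite sqrtCK.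
pose l := (z + d) / 2%:R; pose m := (z - d) / 2%:R.
have lm : l * m = 1.
  transitivity ((z ^+ 2 - d ^+ 2) / 4%:R); first by rewrite /l /m; field.
  by rewrite d2; field.
have nl : l != 0 by apply: contra_eq_neq lm => ->; rewrite mul0r eq_sym oner_eq0.
have lV : l^-1 = m by apply: (mulfI nl); rewrite divff.
have [||r [Hr ra rw]] := @SL2_rep_ex C (mx22 x (-1) 1 0) (mx22 0 l (- l^-1) y).
- by rewrite det_mx2 !mxE /= mulr0 sub0r mulr1 opprK.
- by rewrite det_mx2 !mxE /= mul0r sub0r mulrN opprK divff.
have [_ _ rM] := Hr.
have E : pt r =1 pt3 x y z.
  suff zE : \tr (r (a * w)%g) = z by rewrite /pt zE ra rw !mx22_tr addr0 add0r.
  by rewrite rM ra rw mx22_mul mx22_tr lV /l /m; field.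
by rewrite mevalB -!(meval_eq _ E) (pq x y l r) ?subrr.
Qed.

Lemma tpE r u : SL2_rep r -> (tp u).@[pt r] = \tr (r u).
Proof. by move=> Hr; rewrite (trace_polyP u Hr). Qed.

Lemma XE r : X.@[pt r] = \tr (r a). Proof. by rewrite mevalXU. Qed.
Lemma YE r : Y.@[pt r] = \tr (r w). Proof. by rewrite mevalXU. Qed.
Lemma ZE r : Z.@[pt r] = \tr (r (a * w)%g). Proof. by rewrite mevalXU. Qed.

Lemma tpC u v : tp (u * v)%g = tp (v * u)%g.
Proof.
apply: mpoly_rep_eq => x y l r [Hr _ _ _]; have [_ _ rM] := Hr.
by rewrite !tpE // !rM mxtrace_mulC.
Qed.

Lemma tp_inv u g v :
  tp (u * g^-1 * v)%g = tp g * tp (u * v)%g - tp (u * g * v)%g.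
Proof.
apply: mpoly_rep_eq => x y l r [Hr _ _ _]; have [_ _ rM] := Hr.
rewrite mevalB mevalM !tpE // !rM SL2_repV // mulmxBr mulmxBl linearB /=.
by rewrite mul_mx_scalar -scalemxAl mxtraceZ.
Qed.

(** This is the polarised Cayley-Hamilton identity; it lets [a] move to the left of [w]. *)
Lemma tp_swap u v :
  tp (u * w * a * v)%g = X * tp (u * w * v)%g + Y * tp (u * a * v)%g
    + (Z - X * Y) * tp (u * v)%g - tp (u * a * w * v)%g.
Proof.
apply: mpoly_rep_eq => x y l r [Hr _ _ _]; have [_ _ rM] := Hr.
rewrite !(mevalB, mevalD, mevalM) XE YE ZE !tpE // !rM.
rewrite -[r u *m r w *m r a]mulmxA (swap_mx2 (r a)).
rewrite !mulmxBr !mulmxDr !mulmxBl !mulmxDl !linearB !linearD /=.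
by rewrite mul_mx_scalar -!scalemxAr -!scalemxAl !mxtraceZ !mulmxA.
Qed.

(** By Cayley-Hamilton the powers of [r w] obey the Chebyshev recursion. Negative powers follow from
    [r (g^-1) = tr (r g) - r g] and the reflection [chebS_opp]. *)
Lemma rep_zexpg (r : F2 -> 'M[C]_2) k : SL2_rep r ->
  r (zexpg w k) = chebS (\tr (r w)) (k - 1) *: r w - (chebS (\tr (r w)) (k - 2))%:M.
Proof.
move=> Hr; have [rdet r1 rM] := Hr; set y := \tr (r w).
have nat_case (m : nat) :
    r (w ^+ m)%g = chebS y (m%:Z - 1) *: r w - (chebS y (m%:Z - 2))%:M.
  elim: m => [|m IH].
    rewrite expg0 r1 (chebS_pred y 0) !sub0r chebSN1 chebS0 mulr0 scale0r.
    by rewrite !sub0r raddfN opprK.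
  rewrite expgS rM IH mulmxBr mul_mx_scalar -scalemxAr cayley2 // -/y.
  rewrite (_ : m.+1%:Z - 1 = m) 1?(_ : m.+1%:Z - 2 = m%:Z - 1); [|lia..].
  have -> : chebS y m = y * chebS y (m%:Z - 1) - chebS y (m%:Z - 2).
    by rewrite chebS_pred; ring.
  by apply: mx2P; rewrite !mxE /= ?(mulr1n, mulr0n); ring.
case: k => m /=; first exact: nat_case.
rewrite SL2_repV // nat_case linearB linearZ /= -/y mxtrace_scalar.
rewrite (_ : Negz m - 1 = - m.+2%:Z) 1?(_ : Negz m - 2 = - m.+3%:Z); [|lia..].
rewrite !chebS_opp (_ : m.+2%:Z - 2 = m) 1?(_ : m.+3%:Z - 2 = m%:Z + 1); [|lia..].
rewrite chebS_rec (_ : m.+1%:Z - 1 = m) 1?(_ : m.+1%:Z - 2 = m%:Z - 1); [|lia..].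
by apply: mx2P; rewrite !mxE /= ?(mulr1n, mulr0n); ring.
Qed.

(** * Traces of the knot relation *)

Section Relation.
Variable n : int.
Local Notation P := (pretzelP X Y Z).
Local Notation s := (chebS Y (n - 1)).
Local Notation t := (chebS Y (n - 2)).
Local Notation Q := (pretzelQ X Y Z s t).

(** In each representation this is a linear function of [r h], so its values at 1, a, w and aw
    govern all others. *)
Definition reldiff (h : F2) : {mpoly C[3]} :=
  tp (zexpg w n * knot_E * h)%g - tp (knot_F * zexpg w n * h)%g.

Lemma knot_mx x y l r : normal_rep x y l r ->
  r knot_E = mx22 (- x * l ^+ 2 + y * l)
    (x ^+ 2 * l ^+ 2 + x ^+ 2 - 2%:R * x * y * l - x * y / l + y ^+ 2 + l ^- 2)
    (- l ^+ 2) (x * l ^+ 2 + x - y * l) /\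
  r knot_F = mx22 (x * y * l ^- 2 + x * y - y ^+ 2 / l - l ^- 3)
    (- x * l - x / l + y)
    (x ^+ 2 * y * l ^- 2 + x ^+ 2 * y - x * y ^+ 2 * l - 2%:R * x * y ^+ 2 / l
      - x * l ^- 3 + y ^+ 3 + y * l ^+ 2 + y * l ^- 2)
    (- x ^+ 2 * l - x ^+ 2 / l + x * y * l ^+ 2 + 2%:R * x * y - y ^+ 2 * l - l ^+ 3).
Proof.
move=> [Hr nl ra rw]; have [_ _ rM] := Hr.
have raV : r (a^-1)%g = mx22 0 1 (-1) x.
  by rewrite SL2_repV // ra mx22_tr; apply: mx2P; rewrite !mxE /= ?(mulr1n, mulr0n); ring.
have rwV : r (w^-1)%g = mx22 y (- l) l^-1 0.
  by rewrite SL2_repV // rw mx22_tr; apply: mx2P; rewrite !mxE /= ?(mulr1n, mulr0n); ring.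
rewrite /knot_E /knot_F !rM raV rwV ra rw !mx22_mul.
by split; apply: mx2P; rewrite !mxE /=; field.
Qed.

Lemma reldiff_basis :
  [/\ reldiff 1%g = (- s - t) * P, reldiff a = Q, reldiff w = (- Y * s - s + t) * P
    & reldiff (a * w)%g = (X * Y * t - X * s - Z * t) * P + (Y - 1) * Q].
Proof.
have evS r k : (chebS Y k).@[pt r] = chebS (\tr (r w)) k.
  by rewrite (rmorph_chebS (meval (pt r))) /= YE.
have evP r : P.@[pt r] = pretzelP (\tr (r a)) (\tr (r w)) (\tr (r (a * w)%g)).
  by rewrite (rmorph_pretzelP (meval (pt r))) /= XE YE ZE.
have evQ r : Q.@[pt r] = pretzelQ (\tr (r a)) (\tr (r w)) (\tr (r (a * w)%g))
    (chebS (\tr (r w)) (n - 1)) (chebS (\tr (r w)) (n - 2)).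
  by rewrite (rmorph_pretzelQ (meval (pt r))) /= XE YE ZE !evS.
pose ev := (evP, evQ, evS, mevalD, mevalN, mevalM, meval1, XE, YE, ZE).
split; apply: mpoly_rep_eq => x y l r nr; have [rE rF] := knot_mx nr;
  have [Hr nl ra rw] := nr; have [_ r1 rM] := Hr;
  have rwn := rep_zexpg n Hr;
  rewrite /reldiff; move: (knot_E) (knot_F) rE rF => E F rE rF;
  rewrite !ev !tpE // !rM ?r1 rwn rE rF ra rw.
all: rewrite !mx22_tr add0r addr0.
(* [s] and [t] become free variables: both sides are linear in them, and the identities hold
   coefficientwise. *)
all: move: (chebS y (n - 1)) (chebS y (n - 2)) => s t.
all: have -> : s *: mx22 0 l (- l^-1) y - t%:M
   = mx22 (- t) (s * l) (- s / l) (s * y - t)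
   by apply: mx2P; rewrite !mxE /= ?(mulr1n, mulr0n); ring.
all: rewrite ?mulmx1 !mx22_mul !mx22_tr ?/pretzelP ?/pretzelQ.
all: field.
all: exact: nl.
Qed.

End Relation.
End Representations.

(** * The ideal of the character ring *)

Section CharacterIdeal.
Variables (C : numClosedFieldType) (n : int).
Local Notation tp := (trace_poly C).
Local Notation X := (X C).
Local Notation Y := (Y C).
Local Notation Z := (Z C).
Local Notation P := (pretzelP X Y Z).
Local Notation Q := (pretzelQ X Y Z (chebS Y (n - 1)) (chebS Y (n - 2))).
Local Notation I := (ideal2 P Q).
Local Notation d := (reldiff C n).

Lemma reldiff_inv g l u : d (g * l^-1 * u)%g = tp l * d (g * u)%g - d (g * l * u)%g.
Proof.
rewrite /reldiff; move: (zexpg w n) (knot_E) (knot_F) => W E F.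
by rewrite !mulgA !tp_inv; ring.
Qed.

Lemma reldiff_swap g u : d (g * w * a * u)%g = X * d (g * w * u)%g
  + Y * d (g * a * u)%g + (Z - X * Y) * d (g * u)%g - d (g * a * w * u)%g.
Proof.
rewrite /reldiff; move: (zexpg w n) (knot_E) (knot_F) => W E F.
by rewrite !mulgA !tp_swap; ring.
Qed.

Lemma ideal2B p q : I p -> I q -> I (p - q).
Proof. by move=> Ip Iq; apply: ideal2D => //; apply: ideal2N. Qed.

Lemma reldiff_sqr g l u : I (d (g * l * u)%g) -> I (d (g * u)%g) ->
  I (d (g * l * l * u)%g).
Proof.
move=> Il Iu; have := reldiff_inv (g * l)%g l u; rewrite mulgK => E.
rewrite (_ : d _ = tp l * d (g * l * u)%g - d (g * u)%g); last by rewrite E; ring.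
by apply: ideal2B => //; apply: ideal2Ml.
Qed.

(** Induction on the letters of [h], for a property [V] that also covers left multiplication by a, w
    and aw. Cayley-Hamilton reduces the squares of letters and the inverses, and [reldiff_swap]
    reorders [w a]. *)
Lemma ideal_reldiff h : I (d h).
Proof.
have [e1 ea ew eaw] := reldiff_basis C n.
pose V u := [/\ I (d u), I (d (a * u)%g), I (d (w * u)%g) & I (d (a * w * u)%g)].
have Vswap g u : I (d (g * w * u)%g) -> I (d (g * a * u)%g) -> I (d (g * u)%g) ->
    I (d (g * a * w * u)%g) -> I (d (g * w * a * u)%g).
  move=> i1 i2 i3 i4; rewrite reldiff_swap; apply: ideal2B => //.
  by do 2?apply: ideal2D; apply: ideal2Ml.
have Va u : V u -> V (a * u)%g.
  move=> [i1 ia iw iaw].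
  have iaa : I (d (a * a * u)%g).
    by have := @reldiff_sqr 1%g a u; rewrite !mul1g; apply.
  have iaaw : I (d (a * a * w * u)%g).
    by have := @reldiff_sqr 1%g a (w * u)%g; rewrite !mul1g !mulgA; apply.
  have iwa : I (d (w * a * u)%g).
    by have := @Vswap 1%g u; rewrite !mul1g; apply.
  by split; rewrite ?mulgA //; apply: Vswap.
have Vw u : V u -> V (w * u)%g.
  move=> [i1 ia iw iaw]; split; rewrite ?mulgA //; last exact: reldiff_sqr.
  by have := @reldiff_sqr 1%g w u; rewrite !mul1g; apply.
have VV l u : V u -> V (l * u)%g -> V (l^-1 * u)%g.
  move=> [i1 ia iw iaw] [j1 ja jw jaw]; rewrite !mulgA in ja jw jaw.
  split.
  - have := reldiff_inv 1%g l u; rewrite !mul1g => ->.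
    by apply: ideal2B => //; apply: ideal2Ml.
  - by rewrite mulgA reldiff_inv; apply: ideal2B => //; apply: ideal2Ml.
  - by rewrite mulgA reldiff_inv; apply: ideal2B => //; apply: ideal2Ml.
  - by rewrite mulgA reldiff_inv; apply: ideal2B => //; apply: ideal2Ml.
suff [] : V h by [].
elim/letter_ind: h => [|u Vu|u|u Vu|u]; 
  [|exact: VV (Va _ Vu)|exact: Va|exact: VV (Vw _ Vu)|exact: Vw].
split; rewrite ?mulg1.
- by rewrite e1; exists (- chebS Y (n - 1) - chebS Y (n - 2)), 0; ring.
- by rewrite ea; exists 0, 1; ring.
- by rewrite ew; eexists; exists 0; rewrite mul0r addr0.
- by rewrite eaw; eexists; eexists.
Qed.

Lemma ideal_normal_closure g : normal_closure (fun g => g = knot_relator n) g ->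
  forall h, I (tp (g * h)%g - tp h).
Proof.
elim=> {g} [g ->||g k _ IHg _ IHk|g _ IH|g k _ IH] h.
(* Evaluating [reldiff] at [v^-1 * h] turns its second word into [h] and its first into the relator
   times [h]. *)
- pose v := (knot_F * zexpg w n)%g; have := ideal_reldiff (v^-1 * h)%g.
  rewrite /reldiff -/v mulgA mulVKg.
  by rewrite (_ : (zexpg w n * knot_E * v^-1 * h)%g = (knot_relator n * h)%g).
- by rewrite mul1g subrr; exists 0, 0; ring.
- have := ideal2D (IHg (k * h)%g) (IHk h).
  by rewrite mulgA addrA subrK.
- by rewrite -(opprB (tp h)); apply: ideal2N; have := IH (g^-1 * h)%g; rewrite mulVKg.
(* By cyclicity of the trace, conjugating by [k] amounts to replacing [h] by [k * h * k^-1], which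
   the quantifier over [h] allows. *)
- have E : tp (k * (h * k^-1))%g = tp h by rewrite tpC -mulgA mulVg mulg1.
  by rewrite -E conjgE -!mulgA tpC -!mulgA.
Qed.

Lemma gen_ideal_gen (A : comNzRingType) (S : A -> Prop) p : S p -> gen_ideal S p.
Proof.
by move=> Sp; exists 1%N, (fun=> 1), (fun=> p); rewrite big_ord1 mul1r.
Qed.

Lemma gen_ideal_min (A : comNzRingType) (S : A -> Prop) f g p :
  (forall q, S q -> ideal2 f g q) -> gen_ideal S p -> ideal2 f g p.
Proof.
move=> Sfg [k [c [q [Sq ->]]]]; elim/big_ind: _ => [|u v|i _].
- by exists 0, 0; ring.
- exact: ideal2D.
- by apply: ideal2Ml; apply: Sfg.
Qed.

Lemma char_idealP p : gen_ideal (char_relation (C := C) n) p <-> I p.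
Proof.
split=> [|[u [v ->]]].
  apply: gen_ideal_min => _ [g [h [gh ->]]].
  by have := ideal_normal_closure gh h; rewrite mulgVK.
have [_ ea _ _] := reldiff_basis C n.
apply: gen_idealD; apply: gen_idealMl; apply: gen_ideal_gen; last first.
  exists (zexpg w n * knot_E * a)%g, (knot_F * zexpg w n * a)%g; split=> //.
  by rewrite /eq_in_knot_group invgM mulgA mulgK; apply: ncl_gen.
(* In the knot group F is the conjugate of E by [w^n]; that conjugate has the trace of E, and P is
   the trace of E minus that of F. *)
exists (zexpg w n * knot_E * (zexpg w n)^-1)%g, knot_F; split.
  by rewrite /eq_in_knot_group -mulgA -invgM; apply: ncl_gen.
rewrite tpC mulgA mulVg mul1g; apply: mpoly_rep_eq => x y l r nr.
have [rE rF] := knot_mx nr; have [Hr nl ra rw] := nr; have [_ _ rM] := Hr.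
rewrite mevalB !tpE // rE rF.
rewrite (rmorph_pretzelP (meval (pt r))) /= XE YE ZE rM ra rw mx22_mul !mx22_tr.
by rewrite /pretzelP; field.
Qed.

Lemma PQ_idealP p : gen_ideal (PQ_relation (C := C) n) p <-> I p.
Proof.
have pP : poly_P C = P by rewrite /poly_P /pretzelP; ring.
have pQ : poly_Q C n = Q.
  have n3 : chebS Y (n - 3) = Y * chebS Y (n - 2) - chebS Y (n - 1).
    by rewrite (_ : n - 3 = n - 1 - 2) 1?(_ : n - 2 = n - 1 - 1) ?chebS_pred; [|ring..].
  have n4 : chebS Y (n - 4) = Y * chebS Y (n - 3) - chebS Y (n - 2).
    by rewrite (_ : n - 4 = n - 2 - 2) 1?(_ : n - 3 = n - 2 - 1) ?chebS_pred; [|ring..].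
  have n5 : chebS Y (n - 5) = Y * chebS Y (n - 4) - chebS Y (n - 3).
    by rewrite (_ : n - 5 = n - 3 - 2) 1?(_ : n - 4 = n - 3 - 1) ?chebS_pred; [|ring..].
  by rewrite /poly_Q n5 n4 n3 /pretzelQ; ring.
split=> [|[u [v ->]]].
  by apply: gen_ideal_min => _ [->|->]; [exists 1, 0|exists 0, 1]; rewrite ?pP ?pQ; ring.
by apply: gen_idealD; apply: gen_idealMl; apply: gen_ideal_gen; [left|right].
Qed.

Lemma mpoly_rmorph_id k (th : {rmorphism {mpoly C[k]} -> {mpoly C[k]}}) :
  (forall c, th c%:MP = c%:MP) -> (forall i, th 'X_i = 'X_i) -> forall p, th p = p.
Proof.
move=> thC thX p; rewrite {1}[p]mpolyE rmorph_sum [RHS]mpolyE.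
apply: eq_bigr => m _; rewrite -!mul_mpolyC rmorphM thC mpolyXE_id rmorph_prod.
by congr (_ * _); apply: eq_bigr => i _; rewrite rmorphXn thX.
Qed.

(** [phi] nests the variables with x innermost, and [psi] evaluates them back. Since [psi] after
    [phi] is the identity, membership proved in the nested ring returns to C[x,y,z]. *)
Lemma ideal_radical p k : I (p ^+ k) -> I p.
Proof.
pose T := {poly {poly {poly C}}}.
pose phi : {rmorphism {mpoly C[3]} -> T} :=
  mmap (polyC \o polyC \o polyC : C -> T)
    (fun i : 'I_3 => [:: 'X%:P%:P; 'X%:P; 'X : T]`_i).
pose psi : {rmorphism T -> {mpoly C[3]}} :=
  horner_eval Z \o map_poly
    (horner_eval Y \o map_poly (horner_eval X \o map_poly (@mpolyC 3 C))).
have phX : phi X = 'X%:P%:P by rewrite /phi /= mmapX mmap1U.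
have phY : phi Y = 'X%:P by rewrite /phi /= mmapX mmap1U.
have phZ : phi Z = 'X by rewrite /phi /= mmapX mmap1U.
have psX : psi 'X%:P%:P = X.
  rewrite /= map_polyC [LHS]hornerC /= map_polyC [LHS]hornerC /=.
  by rewrite map_polyX [LHS]hornerX.
have psY : psi 'X%:P = Y.
  by rewrite /= map_polyC [LHS]hornerC /= map_polyX [LHS]hornerX.
have psZ : psi 'X = Z by rewrite /= map_polyX [LHS]hornerX.
have psiphi q : psi (phi q) = q.
  rewrite -[psi (phi q)]/((psi \o phi) q).
  apply: mpoly_rmorph_id => [c|i] /=; last first.
    rewrite mmapX mmap1U; case: i => [[|[|[|//]]]] lti /=.
    - by rewrite -[LHS]/(psi _) psX; congr 'X_ _; apply: val_inj.
    - by rewrite -[LHS]/(psi _) psY; congr 'X_ _; apply: val_inj.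
    - by rewrite -[LHS]/(psi _) psZ; congr 'X_ _; apply: val_inj.
  rewrite mmapC /= map_polyC [LHS]hornerC /= map_polyC [LHS]hornerC /=.
  by rewrite map_polyC [LHS]hornerC.
have phP : phi P = pretzelP 'X%:P%:P 'X%:P 'X by rewrite rmorph_pretzelP phX phY phZ.
have phQ : phi Q = pretzelQ 'X%:P%:P 'X%:P 'X (chebS 'X%:P (n - 1)) (chebS 'X%:P (n - 2)).
  by rewrite rmorph_pretzelQ !(rmorph_chebS phi) phX phY phZ.
move=> [u [v E]].
have [|u' [v' E']] := @pretzel_radical C n (phi p) k.
  by exists (phi u), (phi v); rewrite -phP -phQ -!rmorphM -rmorphD -E rmorphXn.
exists (psi u'), (psi v'); rewrite -[p]psiphi E' rmorphD !(rmorphM psi).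
by rewrite rmorph_pretzelP rmorph_pretzelQ !(rmorph_chebS psi) psX psY psZ.
Qed.

End CharacterIdeal.

(* "Equal", for two quotients of C[x,y,z], means defined by the same ideal. *)
Theorem theorem4p6 (R : realType) (n : int) :
  reduced_ring (char_ring R[i] n) /\
  (forall p : {mpoly R[i][3]},
     gen_ideal (char_relation (C := R[i]) n) p
     <-> gen_ideal (PQ_relation (C := R[i]) n) p).
Proof.
split=> [b k|p]; last first.
  by split=> [/char_idealP/PQ_idealP|/PQ_idealP/char_idealP].
rewrite -[b]quot_repr; move: (repr b) => p bk; rewrite -[RHS](rmorph0 (@quot_pi _ _)).
apply/quot_piP; rewrite subr0; apply/char_idealP/(@ideal_radical _ n p k)/char_idealP.
by rewrite -[_ ^+ _]subr0; apply/quot_piP; rewrite rmorph0 rmorphXn.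
Qed.
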